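(* Let $p$ be a prime number (possibly $p=2$) and let $r \ge 2$ be an integer. Let $K$ be a totally real abelian number field of conductor $p^r$, let $n = [K:\mathbb{Q}]$, and let $D_K$ be the absolute value of the discriminant of $K$. Then the Euclidean minimum $M(K)$ satisfies $$M(K) \le 2^{-n}\sqrt{D_K}.$$
   Context: For a number field $K$ with ring of integers $\mathcal{O}_K$, let $\mathrm{N} : K \to \mathbb{Q}$ be the absolute value of the norm map $N_{K/\mathbb{Q}}$. The Euclidean minimum of $K$ is $M(K) = \sup_{x \in K}\ \inf_{c \in \mathcal{O}_K} \mathrm{N}(x-c)$. The conductor of an abelian number field $K$ is the smallest positive integer $m$ such that $K \subseteq \mathbb{Q}(\zeta_m)$, where $\zeta_m$ is a primitive $m$-th root of unity. *)

(* Defs.v *)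
From HB Require Import structures.
From mathcomp Require Import all_boot all_order all_algebra all_fingroup.
From mathcomp Require Import all_solvable all_field complex.
From mathcomp Require Import boolp classical_sets reals constructive_ereal ereal.

Set Implicit Arguments.
Unset Strict Implicit.
Unset Printing Implicit Defensive.

Import Order.TTheory GRing.Theory Num.Theory.
Local Open Scope ring_scope.

(* A number field is a [K : fieldExtType rat], of degree [\dim {:K}]. *)

(* Matrix of multiplication by [x] on the Q-vector space K; norm and trace do
   not depend on the basis. *)
Definition mul_matrix (K : fieldExtType rat) (x : K) : 'M[rat]_(\dim {:K}) :=
  passmx.mxof (vbasis {:K}) (vbasis {:K}) (amulr x).

Definition nf_norm (K : fieldExtType rat) (x : K) : rat := \det (mul_matrix x).

Definition nf_trace (K : fieldExtType rat) (x : K) : rat := \tr (mul_matrix x).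

Definition in_OK (K : fieldExtType rat) (x : K) : Prop :=
  integralOver (intr : int -> K) x.

Definition integral_basis (K : fieldExtType rat)
    (e : (\dim {:K}).-tuple K) : Prop :=
  basis_of {:K} e /\
  forall x : K, in_OK x <-> forall i, coord e i x \is a Num.int.

Definition tuple_discr (K : fieldExtType rat)
    (e : (\dim {:K}).-tuple K) : rat :=
  \det (\matrix_(i, j) nf_trace (tnth e i * tnth e j)).

(* Integral bases exist and all have the same discriminant, so the default
   value 0 is never used and [xget] does not depend on a choice. *)
Definition nf_discr (K : fieldExtType rat) : rat :=
  xget 0 [set tuple_discr e | e in [set e | @integral_basis K e]]%classic.

(* Taken in the extended reals, where sup and inf need no side condition. *)
Definition euclidean_minimum (R : realType) (K : fieldExtType rat) : \bar R :=
  ereal_sup [set ereal_inf [set (ratr `|nf_norm (x - c)| : R)%:E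
                           | c in [set c : K | in_OK c]]
            | x in [set: K]]%classic.

Definition totally_real (R : realType) (K : fieldExtType rat) : Prop :=
  forall (f : {rmorphism K -> R[i]}) (x : K), complex.Im (f x) = 0.

Definition abelian_field (K : splittingFieldType rat) : Prop :=
  galois 1 {:K} /\ abelian 'Gal({:K} / 1).

(* K embeds in Q(zeta_m); the ambient field L only serves to carry zeta_m. *)
Definition in_cyclotomic (K : fieldExtType rat) (m : nat) : Prop :=
  exists (L : fieldExtType rat) (zeta : L) (f : 'AHom(K, L)),
    m.-primitive_root zeta /\ (limg f <= <<1; zeta>>)%VS.

Definition is_conductor (K : fieldExtType rat) (m : nat) : Prop :=
  [/\ (0 < m)%N, in_cyclotomic K m
    & forall k : nat, (0 < k)%N -> in_cyclotomic K k -> (m <= k)%N].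

(* Main.v *)
Require Import Defs.
From HB Require Import structures.
From mathcomp Require Import all_boot all_order all_algebra all_fingroup.
From mathcomp Require Import all_solvable all_field complex.
From mathcomp Require Import boolp classical_sets reals constructive_ereal ereal.
From mathcomp Require Import integral_char.
From mathcomp Require Import ring lra zify.

Set Implicit Arguments.
Unset Strict Implicit.
Unset Printing Implicit Defensive.

Import Order.TTheory GRing.Theory Num.Theory.
Local Open Scope ring_scope.

(** The bound comes from trace forms.  Let [alpha <> 0] in [K] have nonnegative
    conjugates.  The inequality of arithmetic and geometric means, applied to
    the conjugates of [alpha * (x - c) ^+ 2], gives
      [N (x - c) ^+ 2 * N alpha <= (Tr (alpha * (x - c) ^+ 2) / n) ^+ n],
    while the Gram matrix of the form [Tr (alpha * x * y)] on an integral basis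
    has determinant [N alpha * D_K].  So [N alpha] cancels, and it is enough
    that every [x] has an integral [c] with [Tr (alpha * (x - c) ^+ 2) <= B],
    where [(4 * B / n) ^+ n] is at most the determinant of the Gram matrix
    ([euclidean_minimum_criterion]).

    Both quantities are computed in [L = Q(w)], with [w] a primitive root of
    unity of order [m = p ^ r = p * q].  An element of [L] is a combination
    [\sum_j b_j w ^+ j] over [j] in Z/m, and the only relations are the [b] that
    are constant on the cosets of the subgroup of order [p].  Requiring
    minimum 0 on each coset makes [b] unique, hence invariant under
    [G = Gal(L / K)] for elements of [K], and integral for integral elements,
    because Z[w] is the ring of integers of [L] ([ring_of_integers],
    [coset_normal_fixed], [coset_normal_int]).

    The conductor is exactly [m], so no [s <> 1] in [G] fixes [w ^+ p]
    ([conductor_exclude]).  It follows that if [p] is odd and [s <> 1] raises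
    roots of unity to the power [a], then [a - 1] is a unit modulo [m]
    ([gal_exp_sub1_unit]), and that [G] consists of 1 and complex conjugation
    if [p = 2] ([gal_exp_two]).

    If [p] is odd, take [alpha = 1].  The trace form is then a sum of squares
    [(b_i - b_j) ^+ 2] over pairs in a common coset.  Rounding all coefficients
    at a random threshold makes the mean of each of these squares at most 1/4
    ([simultaneous_rounding], [odd_approximation]).  The number of orbits of
    [G] on the cosets bounds the rank modulo [p] of the Gram matrix divided by
    [q], which makes the discriminant divisible by a large power of [p]
    ([odd_gram_ge]).  The two estimates leave enough room except when
    [p ^ r = 9]; there one also uses that [b_q = b_(-q)], as [K] is real.

    If [p = 2], take [alpha = (1 - w) * (1 - w^-1)].  For this form the sums
    [w ^- t + ... + w ^+ t] with [t < n] are an orthogonal basis of the lattice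
    of integers, all of square [q] ([even_trace], [even_coord_int]), so
    rounding coordinates is enough. *)

(** * Norm and trace through the conjugates *)

Section Conjugates.

Variable K : splittingFieldType rat.
Hypothesis galK : galois 1 {:K}.

Local Notation Gal := 'Gal({:K} / 1)%g.
Local Notation n := (\dim {:K}).

Lemma card_gal_dim : #|Gal| = n.
Proof. by rewrite -galois_dim // dimv1 divn1. Qed.

Definition gal_nth (i : 'I_n) : gal_of {:K} :=
  enum_val (cast_ord (esym card_gal_dim) i).

Lemma big_gal (T : Type) (idx : T) (op : Monoid.com_law idx)
    (F : gal_of {:K} -> T) :
  \big[op/idx]_(s in Gal) F s = \big[op/idx]_i F (gal_nth i).
Proof.
rewrite big_enum_val (reindex (cast_ord (esym card_gal_dim))) //=.
by exists (cast_ord card_gal_dim) => i _; rewrite ?cast_ordK ?cast_ordKV.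
Qed.

Definition conj_mx (e : n.-tuple K) : 'M[K]_n :=
  \matrix_(i, j) gal_nth j (tnth e i).

Lemma gal_nth_inj : injective gal_nth.
Proof. by move=> i j /enum_val_inj/cast_ord_inj. Qed.

(** A linear relation between the columns would be a relation between
    distinct automorphisms, which are linearly independent. *)
Lemma conj_mx_unit (e : n.-tuple K) : basis_of {:K} e -> conj_mx e \in unitmx.
Proof.
move=> eB; rewrite -unitmx_tr unitmxE unitfE; apply/negP=> /det0P[v nz_v v0].
case/negP: nz_v; apply/eqP/rowP=> i; rewrite mxE.
pose c s := \sum_(j | gal_nth j == s) v 0 j.
have cE j : c (gal_nth j) = v 0 j.
  rewrite /c (bigD1 j) //= big1 ?addr0 // => k /andP[/eqP/gal_nth_inj ->].
  by rewrite eqxx.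
have sum0 a : a \in {:K}%VS -> \sum_(s in Gal) c s * s a = 0.
  move=> _; rewrite (coord_basis eB (memvf a)) big_gal.
  under eq_bigr => j _.
    rewrite cE linear_sum mulr_sumr.
    under eq_bigr => k _ do rewrite linearZ /= -scalerAr.
    over.
  rewrite exchange_big big1 //= => k _.
  have /rowP/(_ k) := v0; rewrite !mxE => v0k.
  rewrite -scaler_sumr (_ : \sum_j _ = 0) ?scaler0 // -[RHS]v0k; apply: eq_bigr => j _.
  by rewrite !mxE (tnth_nth 0).
have := gal_independent sum0; move/(_ (gal_nth i) (enum_valP _)).
by rewrite cE.
Qed.

(** The matrix of conjugates diagonalises the multiplication by [x], and the
    eigenvalues are the conjugates of [x]. *)
Lemma conj_mx_mul x :
  map_mx (in_alg K) (mul_matrix x) *m conj_mx (vbasis {:K}) =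
  conj_mx (vbasis {:K}) *m diag_mx (\row_j gal_nth j x).
Proof.
have eB : basis_of {:K} (vbasis {:K}) by apply: vbasisP.
apply/matrixP=> i j; rewrite mul_mx_diag !mxE.
rewrite -rmorphM.
have -> : tnth (vbasis {:K}) i * x = \sum_k mul_matrix x i k *: tnth (vbasis {:K}) k.
  have := passmx.hom_vecof (vbasis {:K}) eB (amulr x) (delta_mx 0 i).
  rewrite passmx.vecof_delta lfunE /= -(tnth_nth 0) => ->.
  rewrite /passmx.vecof -rowE; apply: eq_bigr => k _.
  by rewrite mxE (tnth_nth 0).
rewrite rmorph_sum; apply: eq_bigr => k _ /=.
by rewrite [X in X * _]mxE [X in _ * X]mxE linearZ /= mulr_algl.
Qed.

Lemma mul_matrix_diag x :
  map_mx (in_alg K) (mul_matrix x) = conj_mx (vbasis {:K}) *m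
    diag_mx (\row_j gal_nth j x) *m invmx (conj_mx (vbasis {:K})).
Proof. by rewrite -conj_mx_mul mulmxK ?conj_mx_unit ?vbasisP. Qed.

Lemma nf_norm_gal x : (nf_norm x)%:A = \prod_(s in Gal) s x.
Proof.
have U := conj_mx_unit (vbasisP {:K}).
rewrite big_gal -[LHS]/(in_alg K _) -det_map_mx mul_matrix_diag !det_mulmx det_diag.
rewrite mulrAC -det_mulmx mulmxV // det1 mul1r.
by apply: eq_bigr => i _; rewrite mxE.
Qed.

Lemma nf_trace_gal x : (nf_trace x)%:A = \sum_(s in Gal) s x.
Proof.
have U := conj_mx_unit (vbasisP {:K}).
rewrite big_gal -[LHS]/(in_alg K _) -trace_map_mx mul_matrix_diag.
rewrite mxtrace_mulC mulmxA mulVmx // mul1mx mxtrace_diag.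
by apply: eq_bigr => i _; rewrite mxE.
Qed.

Definition gram (a : K) (e : n.-tuple K) : 'M[rat]_n :=
  \matrix_(i, j) nf_trace (a * (tnth e i * tnth e j)).

Lemma gram_conj a e :
  map_mx (in_alg K) (gram a e) =
    conj_mx e *m diag_mx (\row_j gal_nth j a) *m (conj_mx e)^T.
Proof.
apply/matrixP=> i j; rewrite !mxE /= nf_trace_gal big_gal.
by apply: eq_bigr => k _; rewrite mul_mx_diag !mxE !rmorphM /= mulrA [X in X * _]mulrC.
Qed.

(** Both Gram matrices factor through the matrix of conjugates; the twist
    only inserts the diagonal matrix of the conjugates of [a]. *)
Lemma det_gram a e : \det (gram a e) = nf_norm a * tuple_discr e.
Proof.
apply: (fmorph_inj (in_alg K)); rewrite rmorphM -det_map_mx gram_conj.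
have -> : tuple_discr e = \det (gram 1 e).
  by congr (\det _); apply/matrixP=> i j; rewrite !mxE mul1r.
rewrite -(det_map_mx (in_alg K) (gram 1 e)) gram_conj.
rewrite /= nf_norm_gal big_gal !det_mulmx !det_diag det_tr.
rewrite (eq_bigr (fun i => gal_nth i a)); last by move=> i _; rewrite mxE.
rewrite [X in _ = _ * (_ * X * _)]big1; last by move=> i _; rewrite mxE rmorph1.
by rewrite mulr1 mulrA [_ * \prod__ _]mulrC.
Qed.

Lemma nf_normM (x y : K) : nf_norm (x * y) = nf_norm x * nf_norm y.
Proof.
apply: (fmorph_inj (in_alg K)); rewrite rmorphM /= !nf_norm_gal -big_split /=.
by apply: eq_bigr => s _; rewrite rmorphM.
Qed.

Lemma nf_norm_neq0 (x : K) : x != 0 -> nf_norm x != 0.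
Proof.
apply: contra_neq => N0; have := nf_norm_gal x; rewrite N0 scale0r => /esym/eqP.
by rewrite prodf_seq_eq0 => /hasP[s _ /andP[_]]; rewrite fmorph_eq0 => /eqP.
Qed.

Lemma tuple_discr_neq0 (e : n.-tuple K) : basis_of {:K} e -> tuple_discr e != 0.
Proof.
move=> eB; rewrite -[tuple_discr e]mul1r.
have <- : nf_norm (1 : K) = 1.
  apply: (fmorph_inj (in_alg K)); rewrite /= nf_norm_gal scale1r.
  by rewrite big1 // => s _; rewrite rmorph1.
rewrite -det_gram -(fmorph_eq0 (in_alg K)) -det_map_mx gram_conj.
have C0 : \det (conj_mx e) != 0 by rewrite -unitfE -unitmxE conj_mx_unit.
rewrite !det_mulmx det_tr det_diag !mulf_neq0 //.
by apply/prodf_neq0 => i _; rewrite mxE rmorph1 oner_neq0.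
Qed.

End Conjugates.
(** * Algebraic integers and integral bases *)

Section Integers.

Lemma in_OK_rmorph (K L : fieldExtType rat) (f : {rmorphism K -> L}) x :
  in_OK (f x) <-> in_OK x.
Proof.
have mapf (p : {poly int}) : map_poly f (map_poly intr p) = map_poly intr p.
  by rewrite -map_poly_comp; apply: eq_map_poly => a /=; rewrite rmorph_int.
split=> -[p p_monic rp]; exists p => //; last by rewrite -mapf fmorph_root.
by rewrite -(fmorph_root f) mapf.
Qed.

(** The same fact is known for the algebraic integers of [algC], so the
    equation satisfied by [a] is moved there. *)
Lemma in_OK_rat (K : fieldExtType rat) (a : rat) :
  in_OK (a%:A : K) -> a \is a Num.int.
Proof.
case=> p p_monic rp.
have ra : root (map_poly intr p) a.
  rewrite -(fmorph_root (in_alg K)) -map_poly_comp.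
  by rewrite (eq_map_poly (g := intr)) // => b /=; rewrite scaler_int.
have ra' : root (map_poly intr p) (ratr a : algC).
  rewrite -(fmorph_root (ratr : rat -> algC)) -map_poly_comp /= in ra.
  by rewrite -(eq_map_poly (f := ratr \o intr)) // => b /=; rewrite ratr_int.
rewrite -(Cint_rat a); apply: Cint_rat_Aint; first exact: Crat_rat.
apply: root_monic_Aint ra' _ _; first by rewrite monic_map.
by apply/polyOverP=> i; rewrite coef_map /= rpred_int.
Qed.

Variable K : splittingFieldType rat.
Local Notation n := (\dim {:K}).

Lemma in_OK_int z : in_OK (z%:~R : K).
Proof. exact: integral_id. Qed.

Lemma in_OK_mul (x y : K) : in_OK x -> in_OK y -> in_OK (x * y).
Proof. exact: integral_mul. Qed.

Lemma in_OK_sub (x y : K) : in_OK x -> in_OK y -> in_OK (x - y).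
Proof. exact: integral_sub. Qed.

Lemma in_OK_add (x y : K) : in_OK x -> in_OK y -> in_OK (x + y).
Proof. exact: integral_add. Qed.

Lemma in_OK_sum (I : Type) (r : seq I) (P : pred I) (F : I -> K) :
  (forall i, P i -> in_OK (F i)) -> in_OK (\sum_(i <- r | P i) F i).
Proof. by move=> FO; elim/big_ind: _ => //; [apply: integral0 | apply: integral_add]. Qed.

Lemma in_OK_intZ (a : rat) (x : K) : a \is a Num.int -> in_OK x -> in_OK (a *: x).
Proof.
move=> /intrP[z ->] xO; rewrite scaler_int -mulrzl.
exact: in_OK_mul (in_OK_int z) xO.
Qed.

Lemma nf_trace_linear : scalar (@nf_trace K).
Proof. move=> a x y; rewrite /nf_trace /mul_matrix linearP.
rewrite [passmx.mxof _ _ _]passmx.mxof_linear.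
by rewrite mxtraceD mxtraceZ. Qed.
HB.instance Definition _ := GRing.isLinear.Build rat K rat *%R (@nf_trace K)
  nf_trace_linear.

(** If [a] clears the denominators of the minimal polynomial [P] of [x], of
    degree [k + 1], then [a ^+ k.+1 * P (X / a)] is monic with integral
    coefficients, and it vanishes at [a * x]. *)
Lemma in_OK_denominator (x : K) : exists2 a : int, a != 0 & in_OK (a%:~R * x).
Proof.
have /polyOver1P[p Dp] := minPolyOver 1 x.
have p_monic : p \is monic.
  by rewrite -(map_monic (in_alg K)) -Dp monic_minPoly.
have rp : root (map_poly (in_alg K) p) x by rewrite -Dp root_minPoly.
have [q [a a0 Dq]] := rat_poly_scale p.
have ap i : a%:~R * p`_i = (q`_i)%:~R.
  by rewrite Dq coefZ mulrA mulfV ?intr_eq0 // mul1r coef_map.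
have sp : (1 < size p)%N.
  rewrite ltnNge; apply/negP=> /size1_polyC Ep.
  move: rp p_monic; rewrite Ep map_polyC rootC fmorph_eq0 => /eqP ->.
  by rewrite monicE lead_coefC eq_sym oner_eq0.
pose k := (size p).-2; have Dk : size p = k.+2 by rewrite /k; case: (size p) sp => [|[]].
exists a => //.
pose r := \poly_(i < k.+2) (if i == k.+1 then 1 else q`_i * a ^+ (k - i)).
have r_coef : r`_k.+1 = 1 by rewrite coef_poly ltnSn eqxx.
have sr : size r = k.+2 by rewrite size_poly_eq // eqxx oner_neq0.
exists r; first by rewrite monicE lead_coefE sr r_coef.
rewrite rootE (@horner_coef_wide _ k.+2); last by rewrite -sr; apply: size_poly.
apply/eqP.
transitivity (a%:~R ^+ k.+1 * (map_poly (in_alg K) p).[x]); last first.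
  by rewrite (rootP rp) mulr0.
rewrite horner_coef size_map_poly Dk mulr_sumr; apply: eq_bigr => i _.
rewrite !coef_map coef_poly ltn_ord /= exprMn mulrA [RHS]mulrA; congr (_ * _).
case: eqP => [-> | /eqP nik].
  move: p_monic; rewrite monicE lead_coefE Dk => /eqP ->.
  by rewrite scale1r mulr1 mul1r.
have ik : (i <= k)%N by have := ltn_ord i; rewrite ltnS leq_eqVlt (negPf nik).
rewrite rmorphM rmorphXn /= -mulrA -exprD subnK // exprS mulrAC; congr (_ * _).
by rewrite mulrzl -[RHS]scaler_int scalerA ap scaler_int.
Qed.

Lemma gram_basis_change a (e e' : n.-tuple K) : basis_of {:K} e ->
  let A := \matrix_(i, j) coord e j (tnth e' i) in
  gram a e' = A *m gram a e *m A^T.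
Proof.
move=> eB A; apply/matrixP=> i j.
have De k : tnth e' k = \sum_l A k l *: tnth e l.
  rewrite [LHS](coord_basis eB (memvf _)); apply: eq_bigr => l _.
  by rewrite mxE -tnth_nth.
rewrite mxE !De mulr_suml mulr_sumr.
rewrite linear_sum -mulmxA mxE; apply: eq_bigr => k _ /=.
rewrite -scalerAl -scalerAr linearZ /=; congr (_ * _).
rewrite !mulr_sumr linear_sum [RHS]mxE; apply: eq_bigr => l _ /=.
by rewrite -!scalerAr linearZ /= mulrC; congr (_ * _); rewrite !mxE.
Qed.

Lemma tuple_discr_gram (e : n.-tuple K) : tuple_discr e = \det (gram 1 e).
Proof. by congr (\det _); apply/matrixP=> i j; rewrite !mxE mul1r. Qed.

(** A linear relation between the elements of [e] is a vector in the kernel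
    of their Gram matrix. *)
Lemma basis_of_discr (e : n.-tuple K) : tuple_discr e != 0 -> basis_of {:K} e.
Proof.
move=> D0; rewrite basisEfree subvf size_tuple leqnn !andbT.
apply/freeP=> c c0 i; pose v : 'rV_n := \row_i c i.
suff /rowP/(_ i) : v = 0 by rewrite !mxE.
apply/eqP; apply: contraNT D0 => nz_v; rewrite tuple_discr_gram.
apply/det0P; exists v => //; apply/rowP=> j; rewrite !mxE.
transitivity (nf_trace ((\sum_i c i *: e`_i) * tnth e j)).
  rewrite mulr_suml linear_sum; apply: eq_bigr => k _.
  by rewrite !mxE mul1r -scalerAl linearZ (tnth_nth 0 e k).
by rewrite c0 mul0r linear0.
Qed.

Hypothesis galK : galois 1 {:K}.

Lemma nf_trace_int (x : K) : in_OK x -> nf_trace x \is a Num.int.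
Proof.
move=> xO; apply: (@in_OK_rat K); rewrite nf_trace_gal //.
by apply: in_OK_sum => s _; apply/in_OK_rmorph.
Qed.

Lemma tuple_discr_int (e : n.-tuple K) :
  (forall i, in_OK (tnth e i)) -> tuple_discr e \is a Num.int.
Proof.
move=> eO; rewrite rpred_sum // => s _; rewrite rpredMsign rpred_prod // => i _.
by rewrite mxE nf_trace_int //; exact: in_OK_mul.
Qed.

Definition replace (e : n.-tuple K) i x : n.-tuple K :=
  [tuple if k == i then x else tnth e k | k < n].

Lemma tuple_discr_replace (e : n.-tuple K) i x : basis_of {:K} e ->
  tuple_discr (replace e i x) = coord e i x ^+ 2 * tuple_discr e.
Proof.
move=> eB; rewrite !tuple_discr_gram (gram_basis_change _ _ eB).
set A := \matrix_(_, _) _; rewrite !det_mulmx det_tr mulrAC -expr2; congr (_ ^+ 2 * _).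
have AE k j : A k j = if k == i then coord e j x else (k == j)%:R.
  rewrite mxE tnth_mktuple; case: eqP => // _.
  by rewrite (tnth_nth 0) coord_free ?(basis_free eB) // eq_sym.
rewrite (expand_det_col _ i) (bigD1 i) //= AE eqxx big1 ?addr0; last first.
  by move=> k ki; rewrite AE (negPf ki) mul0r.
rewrite /cofactor -signr_odd addnn odd_double mul1r.
rewrite (_ : row' i (col' i A) = 1%:M) ?det1 ?mulr1 //.
apply/matrixP=> k j; rewrite [LHS]mxE [LHS]mxE AE [RHS]mxE.
by rewrite eq_sym (negPf (neq_lift _ _)) (inj_eq lift_inj).
Qed.

(** Among the bases made of integral elements, one with the least absolute
    discriminant is an integral basis. If the coordinate of an integral
    element along [e_i] were not an integer, subtracting integral multiples
    of the basis would give an integral [x'] with coordinate [f] strictly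
    between 0 and 1, and replacing [e_i] by [x'] would multiply the
    discriminant by [f ^+ 2 < 1]. *)
Lemma integral_basis_exists : exists e : n.-tuple K, integral_basis e.
Proof.
pose good (e : n.-tuple K) := basis_of {:K} e /\ forall i, in_OK (tnth e i).
have good_int e : good e -> exists k : nat, `|tuple_discr e| = k%:R.
  move=> [_ eO]; have /intrP[z ->] := tuple_discr_int eO.
  by exists `|z|%N; rewrite natr_absz intr_norm.
pose P k := `[< exists2 e, good e & `|tuple_discr e| = k%:R >].
have exP : exists k, P k.
  have /choice[a aP] : forall i : 'I_n,
      exists a : int, a != 0 /\ in_OK (a%:~R * tnth (vbasis {:K}) i).
    by move=> i; have [a] := in_OK_denominator (tnth (vbasis {:K}) i); exists a.
  pose e : n.-tuple K := [tuple (a i)%:~R * tnth (vbasis {:K}) i | i < n].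
  have eG : good e.
    split=> [|i]; last by rewrite tnth_mktuple; have [] := aP i.
    rewrite basisEfree subvf size_tuple leqnn !andbT.
    have /freeP vfree := basis_free (vbasisP {:K}).
    apply/freeP=> c c0 i.
    have := vfree (fun i => c i * (a i)%:~R); move=> /(_ _ i)/eqP.
    rewrite mulf_eq0 intr_eq0 (negPf (aP i).1) orbF => H; apply/eqP/H.
    rewrite -[RHS]c0; apply: eq_bigr => k _.
    by rewrite -(tnth_nth 0 e) tnth_mktuple (tnth_nth 0) -scalerA scaler_int mulrzl.
  by have [k Dk] := good_int _ eG; exists k; apply/asboolP; exists e.
case: (ex_minnP exP) => k /asboolP[e [eB eO] Dk] kmin.
exists e; split=> // x; split=> [xO i|xi]; last first.
  rewrite (coord_basis eB (memvf x)); apply: in_OK_sum => i _.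
  by apply: in_OK_intZ => //; rewrite -tnth_nth.
apply: contraT => nint.
pose x' := x - \sum_j (Num.floor (coord e j x))%:~R *: e`_j.
have x'O : in_OK x'.
  apply: in_OK_sub => //; apply: in_OK_sum => j _.
  by apply: in_OK_intZ; rewrite -?tnth_nth.
pose f := coord e i x'.
have fE : f = coord e i x - (Num.floor (coord e i x))%:~R.
  by rewrite /f linearB /= coord_sum_free ?(basis_free eB).
have f0 : f != 0.
  by rewrite fE subr_eq0; apply: contra nint => /eqP ->; apply: rpred_int.
have f_ge0 : 0 <= f by rewrite fE subr_ge0 floor_le_tmp.
have f_lt1 : f < 1 by rewrite fE ltrBlDl; have := floorD1_gt (coord e i x); rewrite rmorphD.
have D' := tuple_discr_replace i x' eB; rewrite -/f in D'.
have D0 := tuple_discr_neq0 galK eB.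
have rG : good (replace e i x').
  split; first by apply: basis_of_discr; rewrite D' mulf_neq0 // expf_neq0.
  by move=> j; rewrite tnth_mktuple; case: eqP.
have [l Dl] := good_int _ rG.
have : (k <= l)%N by apply: kmin; apply/asboolP; exists (replace e i x').
rewrite -(ler_nat rat) -Dl -Dk D' normrM leNgt => /negP[].
rewrite gtr_pMl ?normr_gt0 // normrX expr_lt1 // ?normr_ge0 // ger0_norm //.
Qed.

End Integers.
(** * Euclidean minima and twisted trace forms *)

Section Criterion.

Variables (R : realType) (K : splittingFieldType rat).
Hypotheses (galK : galois 1 {:K}) (K_real : totally_real R K).
Variable h : {rmorphism K -> R[i]}.

Local Notation Gal := 'Gal({:K} / 1)%g.
Local Notation n := (\dim {:K}).

Lemma embedding_rat (a : rat) : h a%:A = ratr a.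
Proof. exact: (fmorph_eq_rat (h \o in_alg K) a). Qed.

Lemma embedding_sqr_ge0 (s : gal_of {:K}) x : 0 <= h (s x) ^+ 2.
Proof.
have : h (s x) \is Num.real.
  have := K_real (h \o s : {rmorphism K -> R[i]}) x => /=.
  by case: (h (s x)) => a b /= ->; rewrite complex_real.
by move/complex_realP => [k ->]; rewrite -rmorphXn /= ler0c sqr_ge0.
Qed.

Variable alpha : K.
Hypothesis alpha_neq0 : alpha != 0.
Hypothesis alpha_ge0 : forall s, s \in Gal -> 0 <= h (s alpha).

Lemma nf_norm_twist_gt0 : 0 < nf_norm alpha.
Proof.
rewrite lt_neqAle eq_sym nf_norm_neq0 //=.
rewrite -(ler_rat R[i]) rmorph0 -embedding_rat nf_norm_gal // rmorph_prod.
exact: prodr_ge0.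
Qed.

Lemma twisted_square_ge0 y : {in Gal, forall s : gal_of {:K}, 0 <= h (s (alpha * y ^+ 2))}.
Proof.
move=> s sG; rewrite !rmorphM /= mulr_ge0 ?alpha_ge0 //.
exact: embedding_sqr_ge0.
Qed.

Lemma twisted_trace_ge0 y : 0 <= nf_trace (alpha * y ^+ 2).
Proof.
rewrite -(ler_rat R[i]) rmorph0 -embedding_rat nf_trace_gal // rmorph_sum.
exact: sumr_ge0 (twisted_square_ge0 y).
Qed.

(** This is the inequality of arithmetic and geometric means for the
    conjugates of [alpha * y ^+ 2]. *)
Lemma norm_le_twisted_trace y :
  nf_norm y ^+ 2 * nf_norm alpha <= (nf_trace (alpha * y ^+ 2) / n%:R) ^+ n.
Proof.
have [] := leif_AGM (twisted_square_ge0 y); rewrite card_gal_dim // => + _.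
rewrite -(rmorph_sum h) -(rmorph_prod h) -nf_trace_gal // -nf_norm_gal //.
rewrite !embedding_rat nf_normM // expr2 nf_normM // -expr2 mulrC => le.
by rewrite -(ler_rat R[i]) rmorphXn fmorph_div rmorph_nat.
Qed.

(** The norm of [alpha] is a factor of both the bound on the norm of [x - c]
    and the determinant of the twisted form, so it cancels. *)
Lemma euclidean_minimum_criterion (B : rat) :
  (forall x : K, exists2 c, in_OK c & nf_trace (alpha * (x - c) ^+ 2) <= B) ->
  (forall e, integral_basis e -> (4 * B / n%:R) ^+ n <= `|\det (gram alpha e)|) ->
  (euclidean_minimum R K <=
     (2 ^- (\dim {:K}) * Num.sqrt (ratr `|nf_discr K|) : R)%:E)%E.
Proof.
move=> approx gram_ge.
have [e eB ->] : exists2 e : n.-tuple K,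
    integral_basis e & nf_discr K = tuple_discr e.
  have [e0 e0B] := integral_basis_exists galK.
  have : [set tuple_discr e | e in [set e | @integral_basis K e]]%classic (nf_discr K).
    by apply: xgetPex; exists (tuple_discr e0), e0.
  by case=> e eB <-; exists e.
apply: ge_ereal_sup => _ [x _ <-]; apply: ge_ereal_inf.
have [c cO le_B] := approx x.
exists (ratr `|nf_norm (x - c)|)%:E; first by exists c.
rewrite lee_fin.
set N := nf_norm (x - c); set D := tuple_discr e.
have D_ge : 4 ^+ n * N ^+ 2 <= `|D|.
  rewrite -(ler_pM2r nf_norm_twist_gt0) -[X in _ <= _ * X]gtr0_norm ?nf_norm_twist_gt0 //.
  rewrite -normrM [D * _]mulrC -det_gram // -mulrA.
  apply: le_trans (gram_ge e eB).
  rewrite -mulrA exprMn ler_pM2l ?exprn_gt0 //.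
  apply: le_trans (norm_le_twisted_trace _) _.
  have tr_ge0 := twisted_trace_ge0 (x - c).
  rewrite lerXn2r ?nnegrE ?divr_ge0 ?ler0n ?(le_trans tr_ge0) //.
  by rewrite ler_pM2r ?invr_gt0 ?ltr0n ?adim_gt0.
rewrite ler_pdivlMl ?exprn_gt0 //.
have N_ge0 : 0 <= ratr `|N| :> R by rewrite ler0q.
have D_ge0 : 0 <= ratr `|D| :> R by rewrite ler0q.
rewrite -(@ler_sqr R) ?nnegrE ?sqrtr_ge0 ?(mulr_ge0 _ N_ge0) ?exprn_ge0 //.
rewrite sqr_sqrtr // exprMn -exprM mulnC exprM -natrX.
have -> : (2 ^ 2)%:R = ratr 4%:R :> R by rewrite ratr_nat.
have : ratr (4 ^+ n * `|N| ^+ 2) <= ratr `|D| :> R.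
  by rewrite ler_rat real_normK ?num_real.
by rewrite rmorphM !rmorphXn.
Qed.

End Criterion.
(** * Rounding many rationals at once *)

Section Rounding.

Lemma sum_step (M a b : nat) : (a <= b <= M)%N ->
  \sum_(k < M) ((a <= k < b)%:R : rat) = b%:R - a%:R.
Proof.
move=> /andP[ab bM]; rewrite -(big_mkord predT (fun k => ((a <= k < b)%:R : rat))).
rewrite (big_cat_nat (leq0n a) (leq_trans ab bM)) (big_cat_nat ab bM) /=.
rewrite big_nat big1 ?add0r => [|k /andP[_ ka]]; last by rewrite leqNgt ka.
rewrite [X in _ + X]big_nat [X in _ + X]big1 ?addr0 => [|k /andP[bk _]]; last first.
  by rewrite ltnNge bk andbF.
rewrite big_nat (eq_bigr (fun=> 1)) => [|k ->] //.
by rewrite -big_nat sumr_const_nat natrB.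
Qed.

(** With [D = (b - a) / M], the difference is [1 - D] for the [b - a]
    thresholds [k] from [a] to [b - 1] and [- D] for the others, so that the
    sum is [M * D * (1 - D)]. *)
Lemma sum_step_square_le (M a b : nat) : (a <= b <= M)%N -> (0 < M)%N ->
  \sum_(k < M) ((a%:R / M%:R + (a <= k)%:R) - (b%:R / M%:R + (b <= k)%:R)) ^+ 2
    <= M%:R / 4 :> rat.
Proof.
move=> abM M_gt0; have /andP[ab bM] := abM.
set D : rat := (b%:R - a%:R) / M%:R.
have M0 : (M%:R : rat) != 0 by rewrite pnatr_eq0 -lt0n.
rewrite (eq_bigr (fun k : 'I_M => D ^+ 2 + (1 - 2 * D) * (a <= k < b)%:R)); last first.
  move=> k _; rewrite /D mulrBl.
  have [ak|ka] := leqP a k; have [bk|kb] := leqP b k => /=; try ring.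
  by have := leq_ltn_trans (leq_trans ab bk) ka; rewrite ltnn.
rewrite big_split /= sumr_const card_ord -mulr_sumr sum_step // -[_ *+ M]mulr_natr.
have -> : b%:R - a%:R = D * M%:R by rewrite divfK.
have -> : D ^+ 2 * M%:R + (1 - 2 * D) * (D * M%:R) =
  M%:R / 4 - M%:R * (D - 2^-1) ^+ 2 by field.
by rewrite lerBlDr lerDl mulr_ge0 ?sqr_ge0.
Qed.

Lemma sum_step_square (M a b : nat) : (a <= M)%N -> (b <= M)%N -> (0 < M)%N ->
  \sum_(k < M) ((a%:R / M%:R + (a <= k)%:R) - (b%:R / M%:R + (b <= k)%:R)) ^+ 2
    <= M%:R / 4 * (a != b)%:R :> rat.
Proof.
move=> aM bM M_gt0; have [->|_] := eqVneq a b.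
  by rewrite mulr0 big1 // => k _; rewrite subrr expr0n.
rewrite mulr1; have [ab|/ltnW ba] := leqP a b.
  by apply: sum_step_square_le; rewrite ?ab.
under eq_bigr => k _ do rewrite -sqrrN opprB.
by apply: sum_step_square_le; rewrite ?ba.
Qed.

Lemma common_denominator (I : finType) (b : I -> rat) :
  exists2 M : nat, (0 < M)%N & forall i, M%:R * b i \is a Num.int.
Proof.
exists (\prod_i `|denq (b i)|)%N.
  by apply: prodn_gt0 => i; rewrite absz_gt0 denq_neq0.
move=> i; rewrite (bigD1 i) //= natrM mulrAC rpredM ?rpred_nat //.
rewrite pmulrn abszE gtr0_norm ?denq_gt0 // mulrC -[X in X * _]divq_num_den.
by rewrite divfK ?rpred_int // intr_eq0 denq_neq0.
Qed.

(** For a common denominator [M] and each threshold [k < M], round [x] to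
    its floor, or one less if the fractional part of [x] is at most [k / M].
    When the fractional parts of two entries differ by [D], the square of
    the difference of their remainders has mean [D * (1 - D) <= 1/4] over
    all thresholds. Hence the average of the whole sum over the thresholds
    satisfies the bound, and so does its value for some threshold. *)
Lemma simultaneous_rounding (I : finType) (b : I -> rat) (e : rel I) :
  exists2 f : rat -> rat, forall x, f x \is a Num.int &
    \sum_i \sum_(j | e i j) ((b i - f (b i)) - (b j - f (b j))) ^+ 2 <=
      (\sum_i #|[pred j | e i j && (b i != b j)]|)%:R / 4.
Proof.
have [M M_gt0 MZ] := common_denominator b.
have M0 : (M%:R : rat) != 0 by rewrite pnatr_eq0 -lt0n.
pose fr (x : rat) := x - (Num.floor x)%:~R.
pose f (k : nat) (x : rat) : rat := (Num.floor x)%:~R - ((M%:R * fr x <= k%:R)%R : bool)%:R.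
have fr_ge0 x : 0 <= fr x by rewrite subr_ge0 floor_le_tmp.
have fr_lt1 x : fr x < 1.
  by rewrite ltrBlDl; have := floorD1_gt x; rewrite rmorphD.
have /choice[a aE] : forall i, exists a : nat, M%:R * fr (b i) = a%:R.
  move=> i; apply/natrP; rewrite natrEint mulr_ge0 // andbT /fr mulrBr rpredB //.
  by rewrite rpredM ?rpred_nat ?rpred_int.
have aM i : (a i <= M)%N.
  rewrite -(ler_nat rat) -aE -[leRHS]mulr1 ler_wpM2l // ltW //.
have frE i : fr (b i) = (a i)%:R / M%:R by rewrite -aE mulrAC mulfV // mul1r.
have yE i k : b i - f k (b i) = (a i)%:R / M%:R + (a i <= k)%:R.
  by rewrite /f aE ler_nat opprB addrA -frE /fr addrAC.
pose V k := \sum_i \sum_(j | e i j) ((b i - f k (b i)) - (b j - f k (b j))) ^+ 2.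
pose W := (\sum_i #|[pred j | e i j && (b i != b j)]|)%:R / 4 : rat.
have sumV : \sum_(k < M) V k <= M%:R * W.
  rewrite /V exchange_big /W /= mulrA natr_sum mulrAC mulr_sumr ler_sum // => i _.
  rewrite exchange_big /= -sum1_card natr_sum mulr_sumr.
  rewrite [leRHS](eq_bigl (fun j => e i j && (b i != b j))); last by move=> j; rewrite inE.
  rewrite big_mkcondr /= ler_sum // => j _.
  under eq_bigr => k _ do rewrite !yE.
  apply: le_trans (sum_step_square (aM i) (aM j) M_gt0) _.
  have [bij|_] := eqVneq (b i) (b j) => /=.
    have /eqP : (a i)%:R = (a j)%:R :> rat by rewrite -!aE bij.
    by rewrite eqr_nat => ->; rewrite mulr0.
  by rewrite mulr1 ler_piMr ?divr_ge0 // lern1 leq_b1.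
have [k Vk|noV] := pickP (fun k : 'I_M => V k <= W).
  exists (f k) => // x; rewrite rpredB ?rpred_int ?rpred_nat //.
have : \sum_(k < M) W < \sum_(k < M) V k.
  apply: ltr_sum => [|k _]; last by rewrite ltNge noV.
  by apply/hasP; exists (Ordinal M_gt0); rewrite ?mem_index_enum.
rewrite sumr_const card_ord -[W *+ M]mulr_natl => lt.
by have := le_lt_trans sumV lt; rewrite ltxx.
Qed.

End Rounding.
(** * Determinants of low rank modulo a scalar *)

(** The matrix [c *: U - X *m Y] is the Schur complement of the identity
    block in [block_mx (c *: U) X Y 1%:M]. Multiplying the last [k] rows of
    that block matrix by [c] makes its first [n] columns divisible by [c]. *)
Lemma det_low_rank (R : comNzRingType) (n k : nat) (c : R) (U : 'M[R]_n)
    (X : 'M_(n, k)) (Y : 'M_(k, n)) :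
  c ^+ k * \det (c *: U - X *m Y) = c ^+ n * \det (block_mx U X Y c%:M).
Proof.
have <- : \det (block_mx (c *: U) X Y 1%:M) = \det (c *: U - X *m Y).
  have <- : \det (block_mx 1%:M (- X) 0 (1%:M : 'M_k) *m
      block_mx (c *: U) X Y 1%:M) = \det (block_mx (c *: U) X Y 1%:M).
    by rewrite det_mulmx det_ublock !det1 !mul1r.
  rewrite mulmx_block !mul1mx !mul0mx mulmx1 subrr !add0r mulNmx det_lblock.
  by rewrite det1 mulr1.
have <- : \det (block_mx 1%:M 0 0 c%:M *m block_mx (c *: U) X Y 1%:M) =
    c ^+ k * \det (block_mx (c *: U) X Y 1%:M).
  by rewrite det_mulmx det_ublock det1 mul1r det_scalar.
have <- : \det (block_mx U X Y c%:M *m block_mx c%:M 0 0 1%:M) =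
    c ^+ n * \det (block_mx U X Y c%:M).
  by rewrite det_mulmx det_ublock det1 mulr1 det_scalar mulrC.
rewrite !mulmx_block !mul1mx !mul0mx !mulmx0 !mulmx1 !addr0 !add0r.
by rewrite !mul_scalar_mx !mul_mx_scalar.
Qed.

Lemma det_int (n : nat) (A : 'M[rat]_n) :
  (forall i j, A i j \is a Num.int) -> \det A \is a Num.int.
Proof.
move=> AZ; rewrite rpred_sum // => s _.
by rewrite rpredMsign rpred_prod.
Qed.
(** * Numerical estimates for odd primes *)

Section OddNumerics.

Lemma leq_expn_base a b k : (a <= b)%N -> (a ^ k <= b ^ k)%N.
Proof. by case: k => // k; rewrite leq_exp2r. Qed.

Lemma sqr_le_exp2 k : (5 <= k)%N -> (k ^ 2 <= 2 ^ k)%N.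
Proof.
move=> k5; rewrite -(subnKC k5); elim: (k - 5)%N => [|j IHj] //.
rewrite addnS [leqRHS]expnS; apply: leq_trans (leq_mul (leqnn 2) IHj).
nia.
Qed.

Lemma exp3_le_exp4 k : (4 <= k)%N -> (3 ^ k.+1 <= 4 ^ k)%N.
Proof.
move=> k4; rewrite -(subnKC k4); elim: (k - 4)%N => [|j IHj] //.
rewrite addnS expnS [leqRHS]expnS.
exact: leq_trans (leq_mul (leqnn 3) IHj) (leq_mul (isT : 3 <= 4)%N (leqnn _)).
Qed.

Lemma odd_numeric_ge5 p q d : (5 <= p)%N -> (p <= q)%N -> (d <= p.-1)%N ->
  (p ^ (q + d.-1) <= 2 ^ (q * p.-1))%N.
Proof.
move=> p5 pq dp; rewrite -(leq_exp2r _ _ (isT : 0 < 2)%N) -!expnM mulnC expnM.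
apply: leq_trans (_ : _ <= (2 ^ p) ^ (q + d.-1))%N _.
  by apply: leq_expn_base; apply: sqr_le_exp2.
by rewrite -expnM leq_exp2l //; nia.
Qed.

(** Dropping the term 2 leaves the estimate [p ^ (q + d - 1) <= 2 ^ (q * (p
    - 1))], which can fail only for [p = q = 3]. *)
Lemma odd_numeric p q d m : odd p -> (2 < p)%N -> (p <= q)%N -> (d <= p.-1)%N ->
  m = (q * p)%N ->
  (p ^ (q + d.-1) * (m * p - m - 2) ^ (q * p.-1) <=
     (2 * p.-1 * m) ^ (q * p.-1))%N.
Proof.
move=> p_odd p_gt2 pq dp mq.
have le_base : (m * p - m - 2 <= p.-1 * m)%N.
  by rewrite mulnC -{2}(mul1n m) -mulnBl subn1 leq_subr.
suff [le_p|p3] : (p ^ (q + d.-1) <= 2 ^ (q * p.-1))%N \/ (p = 3 /\ q = 3).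
- by rewrite -mulnA expnMn leq_mul ?leq_expn_base.
- move: p3 => [p3 q3]; rewrite mq q3 p3.
  have -> : (3 * 3 * 3 - 3 * 3 - 2 = 16)%N by [].
  have -> : (2 * 3.-1 * (3 * 3) = 36)%N by [].
  apply: (@leq_trans (3 ^ 4 * 16 ^ 6)).
    rewrite leq_mul2r; apply/orP; right; rewrite leq_exp2l //.
    by move: dp; rewrite p3; case: d => [|[|[|]]].
  change (3 ^ 4 * (4 * 4) ^ 6 <= (4 * (3 * 3)) ^ 6)%N.
  rewrite !expnMn mulnCA leq_mul2l; apply/orP; right.
  (* After cancelling [4 ^ 6], the claim is [3 ^ 4 * 4 ^ 6 <= 9 ^ 6]. *)
  have le48 : (4 ^ 6 <= 3 ^ 8)%N by [].
  rewrite -expnD; apply: leq_trans (leq_mul (leqnn (3 ^ 4)) le48) _.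
  by rewrite -expnD leq_exp2l.
have [p5|p5] := leqP 5 p; first by left; apply: odd_numeric_ge5.
have p3 : p = 3 by move: p_gt2 p5 p_odd; case: p {dp mq pq le_base} => [|[|[|[|[|]]]]].
have [q3|q_gt3] := leqP q 3; first by right; split=> //; apply/eqP; rewrite eqn_leq q3 -p3.
left; rewrite p3 /= mulnC expnM; apply: leq_trans (exp3_le_exp4 q_gt3).
rewrite leq_exp2l // -addn1 leq_add2l.
by move: dp; rewrite p3; case: d => [|[|[|]]].
Qed.

End OddNumerics.
(** * Cyclotomic fields of prime power order *)

Lemma rmorphism_of (A B : nzRingType) (f : A -> B) :
  zmod_morphism f -> monoid_morphism f -> {g : {rmorphism A -> B} | g =1 f}.
Proof.
move=> fB fM; pose mB := GRing.isZmodMorphism.Build A B f fB.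
pose mM := GRing.isMonoidMorphism.Build A B f fM.
by exists (HB.pack_for {rmorphism A -> B} f mB mM).
Qed.

Lemma ahom_of_rmorphism (A B : fieldExtType rat) (f : {rmorphism A -> B}) :
  {g : 'AHom(A, B) | g =1 f}.
Proof.
pose fZ := GRing.isScalable.Build rat A B *:%R f (rat_linear (rmorphB f)).
pose g : {linear A -> B} := HB.pack_for {linear A -> B} (f : A -> B) f fZ.
have g_ahom : ahom_in {:A} (linfun g).
  apply/ahom_inP; split=> [x y _ _|]; rewrite !lfunE /=.
    exact: rmorphM.
  exact: rmorph1.
by exists (AHom g_ahom) => x; rewrite lfunE.
Qed.

Lemma rmorph_rat_alg (A B : fieldExtType rat) (f : {rmorphism A -> B}) (a : rat) :
  f a%:A = a%:A.
Proof. by have [g gE] := ahom_of_rmorphism f; rewrite -gE rmorph_alg. Qed.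

Section PrimePowerCyclotomic.

Variables p r : nat.
Hypotheses (p_prime : prime p) (r_gt1 : (1 < r)%N).
Local Notation m := (p ^ r)%N.
Local Notation q := (p ^ r.-1)%N.

Lemma p_gt1 : (1 < p)%N. Proof. exact: prime_gt1. Qed.
Lemma p_gt0 : (0 < p)%N. Proof. exact: prime_gt0. Qed.
Lemma q_gt0 : (0 < q)%N. Proof. by rewrite expn_gt0 p_gt0. Qed.
Lemma mE : m = (q * p)%N. Proof. by rewrite mulnC -expnS prednK // ltnW. Qed.
Lemma mE' : m = (p * q)%N. Proof. by rewrite mE mulnC. Qed.
Lemma mES : m = (q + q * p.-1)%N.
Proof. by rewrite -mulnS prednK ?p_gt0 // mE. Qed.
Lemma m_gt1 : (1 < m)%N.
Proof. by rewrite -{1}(expn0 p) ltn_exp2l ?p_gt1 ?(ltn_trans _ r_gt1). Qed.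
Lemma m_gt0 : (0 < m)%N. Proof. exact: ltnW m_gt1. Qed.
Lemma p_dvd_q : (p %| q)%N.
Proof. by rewrite -{1}(expn1 p) dvdn_exp2l //; case: r r_gt1 => [|[]]. Qed.

(** The cyclotomic polynomial of order [p ^ r]. *)
Definition cyclo_poly : {poly rat} := \sum_(i < p) ('X^q) ^+ i.

Lemma cyclo_polyE : 'X^m - 1 = ('X^q - 1) * cyclo_poly.
Proof. by rewrite -subrX1 -exprM -mE. Qed.

Lemma size_cyclo_poly : size cyclo_poly = (q * p.-1).+1.
Proof.
have S0 : cyclo_poly != 0.
  apply/eqP=> S0; have /eqP := cyclo_polyE; rewrite S0 mulr0 -size_poly_eq0.
  by rewrite size_XnsubC ?m_gt0.
have := congr1 (fun P : {poly rat} => size P) cyclo_polyE.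
rewrite size_mul // -?size_poly_eq0 !size_XnsubC ?m_gt0 ?q_gt0 //= => /eqP.
by rewrite mES -addnS eqn_add2l => /eqP <-.
Qed.

Lemma cyclo_poly_root (F : fieldType) (h : {rmorphism rat -> F}) z :
  m.-primitive_root z -> root (map_poly h cyclo_poly) z.
Proof.
move=> z_prim; have := congr1 (fun P => (map_poly h P).[z]) cyclo_polyE.
rewrite rmorphM !rmorphB !rmorph1 /= !map_polyXn !hornerE.
rewrite prim_expr_order // subrr => /esym/eqP; rewrite mulf_eq0 subr_eq0.
rewrite -(prim_order_dvd z_prim) => /orP[|//].
rewrite mE -{2}(muln1 q) dvdn_pmul2l ?q_gt0 // dvdn1 => /eqP p1.
by have := p_gt1; rewrite p1.
Qed.

Variables (L : splittingFieldType rat) (w : L).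
Hypotheses (galL : galois 1 {:L}) (w_prim : m.-primitive_root w).
Hypothesis w_gen : <<1; w>>%VS = fullv.
Variable toC : {rmorphism L -> algC}.

(** In [algC] the minimal polynomial of a primitive root of unity of order
    [m] is known to have degree [totient m]. It divides [cyclo_poly], which
    has the same degree. *)
Lemma cyclo_poly_dvd (P : {poly rat}) :
  root (map_poly (in_alg L) P) w -> cyclo_poly %| P.
Proof.
have toC_rat (Q : {poly rat}) :
    root (map_poly ratr Q) (toC w) = root (map_poly (in_alg L) Q) w.
  rewrite -(fmorph_root toC) -map_poly_comp; congr root.
  by apply: eq_map_poly => a; rewrite /= -(fmorph_eq_rat (toC \o in_alg L)).
have w_prim' : m.-primitive_root (toC w) by rewrite fmorph_primitive_root.
have [mu [Dmu _] muP] := minCpolyP (toC w).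
have sz_mu : size mu = (q * p.-1).+1.
  rewrite -(size_map_poly (ratr : {rmorphism rat -> algC})) -Dmu.
  rewrite (minCpoly_cyclotomic w_prim') size_cyclotomic totient_pfactor //.
    by rewrite mulnC.
  exact: ltnW.
have mu_dvd : mu %| cyclo_poly by rewrite -muP toC_rat cyclo_poly_root.
have /eqp_dvdl <- : mu %= cyclo_poly.
  by rewrite -dvdp_size_eqp // sz_mu size_cyclo_poly.
by rewrite -muP toC_rat.
Qed.

Lemma cyclo_gen (x : L) : exists P : {poly rat}, x = (map_poly (in_alg L) P).[w].
Proof.
have : x \in <<1; w>>%VS by rewrite w_gen memvf.
by case/Fadjoin_polyP=> _ /polyOver1P[P ->] ->; exists P.
Qed.

(** The value at [z] of a rational polynomial depends only on its value at
    [w], by [cyclo_poly_dvd]. *)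
Lemma cyclo_embedding (F : fieldType) (h : {rmorphism rat -> F}) z :
  root (map_poly h cyclo_poly) z -> exists f : {rmorphism L -> F}, f w = z.
Proof.
move=> rz; have [P PE] := choice cyclo_gen.
have key Q1 Q2 : (map_poly (in_alg L) Q1).[w] = (map_poly (in_alg L) Q2).[w] ->
    (map_poly h Q1).[z] = (map_poly h Q2).[z].
  move=> E; apply/eqP; rewrite -subr_eq0 -hornerN -hornerD -rmorphB -rootE.
  have /cyclo_poly_dvd/dvdpP[Q ->] : root (map_poly (in_alg L) (Q1 - Q2)) w.
    by rewrite rootE rmorphB hornerD hornerN E subrr.
  by rewrite rmorphM rootM rz orbT.
have [||f fE] := @rmorphism_of L F (fun x => (map_poly h (P x)).[z]).
- move=> x y; rewrite -hornerN -hornerD -rmorphB; apply: key.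
  by rewrite -PE rmorphB hornerD hornerN -!PE.
- split=> [|x y]; last by rewrite -hornerM -rmorphM; apply: key; rewrite rmorphM hornerM -!PE.
  rewrite -[RHS](hornerC 1 z) -(rmorph1 h) -map_polyC; apply: key.
  by rewrite -PE map_polyC hornerC /= scale1r.
exists f; rewrite fE -[RHS](hornerX z) -(map_polyX h); apply: key.
by rewrite -PE map_polyX hornerX.
Qed.

Local Notation Zm := ('Z_m).

(** * Automorphisms and traces of roots of unity *)

Lemma zpn_eq0 n : ((n%:R : Zm) == 0) = (m %| n)%N.
Proof. by rewrite -val_eqE /= val_Zp_nat ?m_gt1. Qed.

Lemma zp_torsionE a b (k : Zm) : m = (a * b)%N -> (0 < a)%N ->
  (a%:R * k == 0) = (b %| k)%N.
Proof.
by move=> Em a_gt0; rewrite -{1}(natr_Zp k) -natrM zpn_eq0 {1}Em dvdn_pmul2l.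
Qed.

Lemma card_zp_torsion a b : m = (a * b)%N -> (0 < a)%N -> (0 < b)%N ->
  #|[pred k : Zm | a%:R * k == 0]| = a.
Proof.
move=> Em a_gt0 b_gt0; pose f (i : 'I_a) : Zm := (b * i)%:R.
have f_val i : f i = (b * i)%N :> nat.
  by rewrite val_Zp_nat ?m_gt1 // modn_small // [ltnRHS]Em mulnC ltn_pmul2r.
have f_inj : injective f.
  move=> i j /(congr1 val) /eqP; rewrite /= !f_val eqn_pmul2l // => /eqP ij.
  exact: val_inj.
rewrite -[RHS](card_ord a) -(card_imset _ f_inj); apply: eq_card => k.
rewrite inE (zp_torsionE _ Em) //; apply/idP/imsetP => [/dvdnP[i Dk] | [i _ ->]].
  have i_lt : (i < a)%N.
    rewrite -(ltn_pmul2r b_gt0) -Dk -Em; have := ltn_ord k.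
    by rewrite [X in (_ < X)%N](Zp_cast m_gt1).
  by exists (Ordinal i_lt) => //; rewrite -[LHS](natr_Zp k) Dk mulnC.
by rewrite f_val dvdn_mulr.
Qed.

Lemma card_Zm : #|Zm| = m.
Proof. by rewrite card_ord (Zp_cast m_gt1). Qed.

Lemma zp_unitE (k : Zm) : (k \is a GRing.unit) = (q%:R * k != 0).
Proof.
rewrite (zp_torsionE _ mE q_gt0) -{1}(natr_Zp k) unitZpE ?m_gt1 //.
by rewrite coprime_pexpl ?prime_coprime // ltnW.
Qed.

Definition wz (j : Zm) : L := w ^+ j.

Lemma wz_nat n : wz n%:R = w ^+ n.
Proof. by rewrite /wz val_Zp_nat ?m_gt1 // prim_expr_mod. Qed.

Lemma wz0 : wz 0 = 1. Proof. by rewrite -[0]/(0%:R) wz_nat. Qed.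

Lemma wzD i j : wz (i + j) = wz i * wz j.
Proof. by rewrite -(natr_Zp i) -(natr_Zp j) -natrD !wz_nat exprD. Qed.

Lemma wzX i (k : Zm) : wz (i * k) = wz i ^+ k.
Proof. by rewrite -{1}(natr_Zp i) -{1}(natr_Zp k) -natrM wz_nat exprM. Qed.

Lemma wzXn i k : wz (i * k%:R) = wz i ^+ k.
Proof. by rewrite -(natr_Zp i) -natrM !wz_nat exprM. Qed.

Lemma wz_inj : injective wz.
Proof.
move=> i j /eqP; rewrite /wz (eq_prim_root_expr w_prim) !modn_small.
- by move/eqP/val_inj.
- by have := ltn_ord j; rewrite [X in (_ < X)%N](Zp_cast m_gt1).
by have := ltn_ord i; rewrite [X in (_ < X)%N](Zp_cast m_gt1).
Qed.

Lemma wz_neq0 j : wz j != 0.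
Proof.
apply/eqP=> w0; have := wzD j (- j); rewrite subrr wz0 w0 mul0r => /eqP.
by rewrite oner_eq0.
Qed.

Lemma wz_eq1 j : (wz j == 1) = (j == 0).
Proof. by rewrite -wz0 (inj_eq wz_inj). Qed.

Local Notation Gam := 'Gal({:L} / 1)%g.

Lemma gal_mem (s : gal_of {:L}) : s \in Gam.
Proof. by rewrite gal_kHom ?sub1v // k1AHom. Qed.

(** The exponent [a] for which [s] maps every root of unity [z] to [z ^+ a]. *)
Definition gal_exp (s : gal_of {:L}) : Zm := odflt 0 [pick j | s w == wz j].

Lemma gal_expE (s : gal_of {:L}) : s w = wz (gal_exp s).
Proof.
rewrite /gal_exp; case: pickP => [j /eqP //| no_j].
have [|i Di] := prim_rootP w_prim (x := s w).
  by rewrite -rmorphXn prim_expr_order // rmorph1.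
by have /eqP := no_j (i%:R); rewrite wz_nat.
Qed.

Lemma gal_wz (s : gal_of {:L}) j : s (wz j) = wz (gal_exp s * j).
Proof. by rewrite wzX -gal_expE -rmorphXn. Qed.

Lemma gal_expM s t : gal_exp (s * t)%g = gal_exp s * gal_exp t.
Proof.
by apply: wz_inj; rewrite -gal_expE galM ?memvf // gal_expE gal_wz mulrC.
Qed.

Lemma gal_exp1 : gal_exp 1%g = 1.
Proof. by apply: wz_inj; rewrite -gal_expE gal_id -[1]/(1%:R) wz_nat expr1. Qed.

Lemma gal_exp_unit (s : gal_of {:L}) : gal_exp s \is a GRing.unit.
Proof.
by apply/unitrPr; exists (gal_exp s^-1%g); rewrite -gal_expM mulgV gal_exp1.
Qed.

Lemma gal_exp_inj : injective gal_exp.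
Proof.
move=> s t st; apply/eqP/gal_eqP => x _; have [P ->] := cyclo_gen x.
rewrite -!horner_map /= !gal_expE st -!map_poly_comp; congr (_.[_]).
by apply: eq_map_poly => a; rewrite /= !rmorph_alg.
Qed.

Lemma gal_exp_onto u : u \is a GRing.unit -> exists s, gal_exp s = u.
Proof.
move=> uU; have u_prim : m.-primitive_root (wz u).
  rewrite /wz prim_root_exp_coprime // coprime_sym.
  by move: uU; rewrite -{1}(natr_Zp u) unitZpE ?m_gt1.
have [f fw] := cyclo_embedding (cyclo_poly_root (in_alg L) u_prim).
have [g gE] := ahom_of_rmorphism f.
have hom_f : kHom 1 {:L} g by rewrite k1HomE; apply: valP g.
have [|s _ sE] := kHom_to_gal _ (normalFieldf 1) hom_f; first by rewrite sub1v subvf.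
by exists s; apply: wz_inj; rewrite -gal_expE -sE ?memvf // gE.
Qed.

Lemma big_gal_exp (F : Zm -> L) :
  \sum_(s in Gam) F (gal_exp s) = \sum_(u | u \is a GRing.unit) F u.
Proof.
pose g u := odflt 1%g [pick s | gal_exp s == u].
rewrite [RHS](reindex gal_exp) /=; last first.
  exists g => [s|u] uU.
    rewrite /g; case: pickP => [t /eqP/gal_exp_inj //|/(_ s)]; by rewrite eqxx.
  rewrite /g; case: pickP => [t /eqP //|no].
  by have [s /eqP] := gal_exp_onto uU; rewrite no.
by apply: eq_bigl => s; rewrite gal_mem gal_exp_unit.
Qed.

Local Notation Tr := (galTrace 1 {:L}).

(** Either all the terms are 1, or the sum is unchanged by the
    multiplication by some [wz (l * j) <> 1]. *)
Lemma wz_sum (H : pred Zm) j :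
  (forall k l, H l -> H (k + l) = H k) ->
  \sum_(k | H k) wz (k * j) =
    if [forall (k | H k), k * j == 0] then #|H|%:R else 0.
Proof.
move=> HD; case: forall_inP => [H0 | /forall_inP/forall_inPn[l Hl lj]].
  by rewrite -sumr_const; apply: eq_bigr => k Hk; rewrite (eqP (H0 k Hk)) wz0.
set S := \sum_(k | _) _; have ES : S = S * wz (l * j).
  rewrite {1}/S (reindex_inj (addIr l)) mulr_suml /=.
  by apply: eq_big => [k|k _]; rewrite ?HD // mulrDl wzD.
have /eqP : S * (wz (l * j) - 1) = 0 by rewrite mulrBr mulr1 -ES subrr.
by rewrite mulf_eq0 subr_eq0 wz_eq1 (negPf lj) orbF => /eqP.
Qed.

(** The conjugates of [wz j] are the [wz (u * j)] for [u] a unit, and the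
    non-units form the subgroup killed by [q], so that this is a difference
    of two sums over subgroups. *)
Lemma Tr_wz j : Tr (wz j) = (j == 0)%:R * m%:R - (p%:R * j == 0)%:R * q%:R.
Proof.
rewrite /galTrace (eq_bigr (fun s => wz (gal_exp s * j))); last first.
  by move=> s _; rewrite gal_wz.
rewrite (big_gal_exp (fun u => wz (u * j))).
apply/eqP; rewrite -subr_eq opprK -(addrC (_ * q%:R)); apply/eqP.
have <- : \sum_(u : Zm | q%:R * u == 0) wz (u * j) = (p%:R * j == 0)%:R * q%:R.
  rewrite wz_sum; last by move=> k l /eqP l0; rewrite mulrDr l0 addr0.
  rewrite (card_zp_torsion mE) ?q_gt0 ?p_gt0 //.
  have -> : [forall (k | q%:R * k == 0), k * j == 0] = (p%:R * j == 0).
    apply/forall_inP/idP => [/(_ p%:R)|pj k].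
      by apply; rewrite -natrM zpn_eq0 -mE.
    rewrite (zp_torsionE _ mE q_gt0) => /dvdnP[l Dk].
    by rewrite -(natr_Zp k) Dk natrM -mulrA (eqP pj) mulr0.
  by case: eqP; rewrite ?mul1r ?mul0r.
have <- : \sum_u wz (u * j) = (j == 0)%:R * m%:R.
  rewrite (wz_sum (H := predT)) //= card_Zm.
  have -> : [forall (k : Zm | true), k * j == 0] = (j == 0).
    apply/forall_inP/eqP => [/(_ 1 isT)|-> k _]; last by rewrite mulr0.
    by rewrite mul1r => /eqP.
  by case: eqP; rewrite ?mul1r ?mul0r.
rewrite [RHS](bigID (fun u : Zm => q%:R * u == 0)) /=.
by congr (_ + _); apply: eq_bigl => u; rewrite -zp_unitE.
Qed.

(** * Coefficients on the roots of unity *)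

(** The map from the group algebra of Z/m to [L]. Its kernel consists of the
    functions that are constant on cosets of the subgroup of order [p]. *)
Definition ev (b : Zm -> rat) : L := \sum_j b j *: wz j.

(** [i] and [j] belong to the same coset of the subgroup of order [p]. *)
Local Notation "i ~~> j" := (p%:R * i == p%:R * j :> Zm) (at level 70).

Lemma ev_ext b b' : b =1 b' -> ev b = ev b'.
Proof. by move=> bb'; apply: eq_bigr => j _; rewrite bb'. Qed.

Lemma evB b b' : ev b - ev b' = ev (fun j => b j - b' j).
Proof. by rewrite -sumrB; apply: eq_bigr => j _; rewrite scalerBl. Qed.

Lemma ev_mul_wz b i : ev b * wz i = ev (fun j => b (j - i)).
Proof.
rewrite /ev [RHS](reindex_inj (addIr i)) /= mulr_suml.
by apply: eq_bigr => j _; rewrite addrK wzD scalerAl.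
Qed.

Lemma ev_gal (s : gal_of {:L}) b : s (ev b) = ev (fun j => b (j / gal_exp s)).
Proof.
have uU := gal_exp_unit s.
rewrite /ev rmorph_sum [RHS](reindex_inj (mulIr uU)) /=.
by apply: eq_bigr => j _; rewrite linearZ /= gal_wz mulrK // mulrC.
Qed.

(** Such a [b] is invariant under translation by [q], so [ev b] is unchanged
    by the multiplication by [wz q <> 1]. *)
Lemma ev_coset_const b : (forall i j, i ~~> j -> b i = b j) -> ev b = 0.
Proof.
move=> bC; have Eb : ev b * wz q%:R = ev b.
  rewrite ev_mul_wz; apply: ev_ext => j; apply: bC.
  by rewrite mulrBr -natrM -mE' -subr_eq0 addrAC subrr sub0r oppr_eq0 zpn_eq0.
have /eqP : ev b * (wz q%:R - 1) = 0 by rewrite mulrBr Eb mulr1 subrr.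
rewrite mulf_eq0 subr_eq0 wz_eq1 zpn_eq0 => /orP[/eqP //|].
rewrite mE' -{2}(mul1n q) dvdn_pmul2r ?q_gt0 // dvdn1 => /eqP p1.
by have := p_gt1; rewrite p1.
Qed.

Lemma Tr_scale (a : rat) x : Tr (a *: x) = a *: Tr x.
Proof. by rewrite /galTrace scaler_sumr; apply: eq_bigr => s _; rewrite linearZ. Qed.

Lemma natr_alg n : n%:R = (n%:R : rat)%:A :> L.
Proof. by rewrite -[RHS]/(in_alg L _) rmorph_nat. Qed.

Lemma natL_eq0 n : (n%:R == 0 :> L) = (n == 0)%N.
Proof. by rewrite natr_alg scaler_eq0 oner_eq0 orbF pnatr_eq0. Qed.

Lemma Tr_ev_wz b i :
  Tr (ev b * wz (- i)) = (m%:R * b i - q%:R * \sum_(j | j ~~> i) b j)%:A.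
Proof.
rewrite mulr_suml raddf_sum /=.
under eq_bigr => j _ do
  rewrite -scalerAl Tr_scale -wzD Tr_wz subr_eq0 mulrBr subr_eq0 scalerBr.
rewrite sumrB scalerBl; congr (_ - _).
  rewrite (bigD1 i) //= big1 ?addr0; last first.
    by move=> j /negPf ->; rewrite mul0r scaler0.
  by rewrite eqxx mul1r (natr_alg m) scalerA mulrC.
rewrite mulr_sumr scaler_suml [RHS]big_mkcond /=; apply: eq_bigr => j _.
by case: eqP => _; rewrite ?mul0r ?scaler0 // mul1r (natr_alg q) scalerA mulrC.
Qed.

Lemma Tr_ev_ev b b' :
  Tr (ev b * ev b') = (m%:R * (\sum_i b i * b' (- i)) -
    q%:R * \sum_i \sum_(j | p%:R * (i + j) == 0) b i * b' j)%:A.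
Proof.
rewrite [ev b']/ev [ev b * _]mulr_sumr raddf_sum /=.
rewrite (eq_bigr (fun i => (m%:R * (b (- i) * b' i) -
   q%:R * \sum_(j | p%:R * (j + i) == 0) b j * b' i)%:A)); last first.
  move=> i _; rewrite -scalerAr Tr_scale -[X in wz X]opprK Tr_ev_wz scalerA.
  congr (_ *: _); rewrite mulrBr mulrCA [b' i * b _]mulrC; congr (_ - _).
  rewrite mulrCA; congr (_ * _); rewrite mulr_sumr.
  apply: eq_big => [j|j _]; last exact: mulrC.
  by rewrite mulrDr mulrN addr_eq0.
rewrite -scaler_suml; congr (_ *: _); rewrite sumrB -!mulr_sumr; congr (_ * _ - _ * _).
  by rewrite (reindex_inj oppr_inj); apply: eq_bigr => i _; rewrite opprK.
by rewrite (exchange_big_dep predT).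
Qed.

(** The traces of the products [ev b * wz (- k)] express [b k] in terms of
    the sum of [b] over the coset of [k]. *)
Lemma ev_eq0_const b i j : ev b = 0 -> i ~~> j -> b i = b j.
Proof.
move=> b0 ij.
have key k : m%:R * b k - q%:R * \sum_(l | l ~~> k) b l = 0.
  apply: (fmorph_inj (in_alg L)); rewrite /= -Tr_ev_wz b0 mul0r.
  by rewrite scale0r raddf0.
have m0 : (m%:R : rat) != 0 by rewrite pnatr_eq0 -lt0n m_gt0.
apply: (mulfI m0); have /eqP := key i; have /eqP := key j.
rewrite !subr_eq0 => /eqP -> /eqP ->; congr (_ * _).
by apply: eq_bigl => l; rewrite (eqP ij).
Qed.

(** Taking the minimum as the normalisation commutes with every permutation
    of Z/m that preserves the cosets, and it keeps integers integral. This
    makes the representative of an element inherit the symmetries of the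
    element. *)
Definition coset_normal (b : Zm -> rat) :=
  forall j, 0 <= b j /\ exists2 i, i ~~> j & b i = 0.

Lemma coset_normal_inj b b' :
  coset_normal b -> coset_normal b' -> ev b = ev b' -> b =1 b'.
Proof.
move=> bN b'N /eqP; rewrite -subr_eq0 evB => /eqP E j.
have dC i : i ~~> j -> b i - b' i = b j - b' j := ev_eq0_const E (j := j).
have [_ [i /dC di bi]] := bN j; have [_ [k /dC dk bk]] := b'N j.
have [[b'i _] [bk' _]] := (b'N i, bN k); move: di dk; rewrite bi bk => di dk; lra.
Qed.

Lemma coset_normal_mul u b : u \is a GRing.unit -> coset_normal b ->
  coset_normal (fun j => b (j * u)).
Proof.
move=> uU bN j; have [b0 [i ij bi]] := bN (j * u); split=> //.
exists (i / u); last by rewrite divrK.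
by rewrite mulrA (eqP ij) mulrA mulrK.
Qed.

Lemma coset_normal_exists b : exists b', [/\ ev b' = ev b, coset_normal b' &
  forall i j, i ~~> j -> b i - b j = b' i - b' j].
Proof.
pose t j := [arg min_(i < j | i ~~> j) b i]%O.
have tP j : t j ~~> j /\ forall i, i ~~> j -> b (t j) <= b i.
  by rewrite /t; case: arg_minP => //= i ij le_i; split.
have tC i j : i ~~> j -> b (t i) = b (t j).
  move=> ij; have [ti lei] := tP i; have [tj lej] := tP j.
  by apply/eqP; rewrite eq_le lei ?lej // ?(eqP tj) ?(eqP ti) // eq_sym.
exists (fun j => b j - b (t j)); split.
- by rewrite -evB [ev (fun j => b (t j))]ev_coset_const ?subr0.
- move=> j; have [tj lej] := tP j; split; first by rewrite subr_ge0 lej.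
  by exists (t j) => //; rewrite (tC (t j) j) ?subrr.
- by move=> i j ij; rewrite (tC i j ij) opprB addrA subrK.
Qed.

Definition poly_coef (P : {poly rat}) (j : Zm) : rat :=
  \sum_(i < size P | i%:R == j) P`_i.

Lemma ev_poly (P : {poly rat}) : ev (poly_coef P) = (map_poly (in_alg L) P).[w].
Proof.
rewrite horner_coef size_map_poly (partition_big (fun i : 'I__ => i%:R : Zm) predT) //=.
apply: eq_bigr => j _; rewrite scaler_suml; apply: eq_bigr => i /eqP <-.
by rewrite wz_nat coef_map /= mulr_algl.
Qed.

Lemma coset_normal_of x : exists2 b, x = ev b & coset_normal b.
Proof.
have [P ->] := cyclo_gen x; rewrite -ev_poly.
by have [b [<- bN _]] := coset_normal_exists (poly_coef P); exists b.
Qed.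

Lemma coset_normal_fixed (s : gal_of {:L}) b : coset_normal b ->
  s (ev b) = ev b -> forall j, b (gal_exp s * j) = b j.
Proof.
move=> bN; rewrite ev_gal => E j; rewrite mulrC.
have uV : (gal_exp s)^-1 \is a GRing.unit by rewrite unitrV gal_exp_unit.
have <- := coset_normal_inj (coset_normal_mul uV bN) bN E (j * gal_exp s).
by rewrite mulrK ?gal_exp_unit.
Qed.

(** * The ring of integers of a cyclotomic field *)

Lemma int_poly_mod_prime (P : {poly int}) :
  map_poly (intr : int -> 'F_p) P = 0 -> exists Q, P = p%:R *: Q.
Proof.
move=> P0; exists (\poly_(i < size P) (P`_i %/ p)%Z); apply/polyP=> i.
rewrite coefZ coef_poly; case: ltnP => [_|iP]; last by rewrite mulr0 nth_default.
rewrite mulrC -[p%:R]/(p%:R : int) natz divzK //.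
have /eqP := congr1 (fun Q : {poly 'F_p} => Q`_i) P0.
rewrite coef0 coef_map /= => Pi0.
by rewrite (dvdz_pcharf (pchar_Fp p_prime)).
Qed.

(** Membership in Z[w]. *)
Definition int_gen (x : L) := exists P : {poly int}, x = (map_poly intr P).[w].

Lemma int_genB x y : int_gen x -> int_gen y -> int_gen (x - y).
Proof. by case=> P -> [Q ->]; exists (P - Q); rewrite rmorphB hornerD hornerN. Qed.

Lemma int_genM x y : int_gen x -> int_gen y -> int_gen (x * y).
Proof. by case=> P -> [Q ->]; exists (P * Q); rewrite rmorphM hornerM. Qed.

Lemma int_gen_int z : int_gen z%:~R.
Proof. by exists z%:P; rewrite map_polyC hornerC. Qed.

Lemma int_genX x n : int_gen x -> int_gen (x ^+ n).
Proof.
by case=> P ->; exists (P ^+ n); rewrite rmorphXn /= horner_exp.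
Qed.

Lemma int_gen_sum (I : finType) (F : I -> L) :
  (forall i, int_gen (F i)) -> int_gen (\sum_i F i).
Proof.
move=> FZ; have [P PE] := choice FZ; exists (\sum_i P i).
by rewrite rmorph_sum horner_sum; apply: eq_bigr => i _; rewrite PE.
Qed.

Lemma in_OK_w : in_OK w.
Proof.
exists ('X^m - 1); first by rewrite monicXnsubC ?m_gt0.
by rewrite rootE rmorphB rmorph1 /= map_polyXn !hornerE prim_expr_order ?subrr.
Qed.

Lemma in_OK_int_gen x : int_gen x -> in_OK x.
Proof.
case=> P ->; rewrite horner_coef; apply: in_OK_sum => i _.
rewrite coef_map /=; apply: in_OK_mul; first exact: in_OK_int.
elim: (i : nat) => [|k IHk]; first exact: (in_OK_int _ 1).
by rewrite exprS; apply: in_OK_mul => //; exact: in_OK_w.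
Qed.

Local Notation pi := (1 - w).

Lemma pi_neq0 : pi != 0.
Proof.
rewrite subr_eq0 eq_sym -(expr1 w) -(prim_order_dvd w_prim) dvdn1.
by rewrite neq_ltn m_gt1 orbT.
Qed.

Lemma int_gen_pi : int_gen pi.
Proof. by exists (1 - 'X); rewrite rmorphB rmorph1 /= map_polyX !hornerE. Qed.

(** Modulo [p], the polynomial [(1 - X) ^+ m] is [1 - X ^+ m], which
    vanishes at [w]. *)
Lemma pi_expm : exists2 y, int_gen y & pi ^+ m = p%:R * y.
Proof.
have [|Q EQ] := @int_poly_mod_prime ((1 - 'X) ^+ m - (1 - 'X^m)).
  rewrite rmorphB rmorphXn !rmorphB !rmorph1 /= map_polyX map_polyXn.
  have pcharP : [pchar {poly 'F_p}].-nat m.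
    by rewrite pnatX pnatE // pchar_poly pchar_Fp.
  by rewrite exprDn_pchar // exprNn_pchar // expr1n subrr.
exists (map_poly intr Q).[w]; first by exists Q.
have := congr1 (fun P => (map_poly (intr : int -> L) P).[w]) EQ.
rewrite map_polyZ !rmorphB rmorphXn !rmorphB !rmorph1 /= map_polyX map_polyXn.
by rewrite !hornerE (prim_expr_order w_prim) subrr subr0 rmorph_nat => <-.
Qed.

Lemma horner1_mod_pi (P : {poly int}) :
  exists2 y, int_gen y & (P.[1])%:~R = (map_poly intr P).[w] + pi * y.
Proof.
have /factor_theorem[Q EQ] : root (P - (P.[1])%:P) 1.
  by rewrite rootE !hornerE subrr.
exists (map_poly intr Q).[w]; first by exists Q.
have /eqP := congr1 (fun P => (map_poly (intr : int -> L) P).[w]) EQ.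
rewrite rmorphB rmorphM rmorphB /= map_polyX !map_polyC !hornerE /=.
rewrite subr_eq => /eqP ->; ring.
Qed.

(** The cyclotomic polynomial has value [p] at 1 and 0 at [w]. *)
Lemma prime_pi : exists2 y, int_gen y & p%:R = pi * y.
Proof.
pose P : {poly int} := \sum_(i < p) ('X^q) ^+ i.
have [y yZ Dy] := horner1_mod_pi P; exists y => //.
have <- : (P.[1])%:~R = p%:R :> L.
  rewrite horner_sum (eq_bigr (fun=> 1)) ?sumr_const ?card_ord ?rmorph_nat //.
  by move=> i _; rewrite -exprM hornerXn expr1n.
rewrite Dy; suff -> : (map_poly intr P).[w] = 0 by rewrite add0r.
apply/eqP; rewrite -rootE.
have := cyclo_poly_root (in_alg L) w_prim; congr (is_true (root _ _)).
rewrite !rmorph_sum; apply: eq_bigr => i _.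
by rewrite /= !rmorphXn /= !map_polyX.
Qed.

(** By [pi_expm], the rational number [a ^+ m / p] is an algebraic integer,
    so [p] divides [a ^+ m]. *)
Lemma prime_dvd_pi (a : int) y : in_OK y -> a%:~R = pi * y -> (p %| `|a|)%N.
Proof.
move=> yO Da; have [z zZ Dz] := pi_expm.
have aE : in_OK (((a ^+ m)%:~R / p%:R : rat)%:A : L).
  have -> : ((a ^+ m)%:~R / p%:R : rat)%:A = z * y ^+ m :> L.
    rewrite -[LHS]/(in_alg L _) rmorphM fmorphV rmorph_nat rmorph_int rmorphXn /=.
    rewrite Da exprMn Dz mulrC !mulrA mulVf ?mul1r // -(rmorph_nat (in_alg L)).
    by rewrite fmorph_eq0 pnatr_eq0 -lt0n p_gt0.
  apply: in_OK_mul; first exact: in_OK_int_gen.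
  by elim: (m) => [|k IHk]; [exact: (in_OK_int _ 1) | rewrite exprS; apply: in_OK_mul].
have /intrP[k Dk] := in_OK_rat aE.
have : (p %| `|a| ^ m)%N.
  suff : (p %| a ^+ m)%Z by rewrite dvdzE abszX.
  apply/dvdzP; exists k; apply: (@intr_inj rat).
  rewrite rmorphM /= -Dk divfK // pmulrn.
  by rewrite pnatr_eq0 -lt0n p_gt0.
by rewrite Euclid_dvdX // => /andP[].
Qed.

(** Let [pi * x = P (w)]. The integer [P (1)] is congruent to [P (w)] modulo
    [pi], so it is a multiple of [pi], hence of [p], hence of [pi] within
    Z[w]. Therefore [P (w)] is a multiple of [pi] within Z[w]. *)
Lemma int_gen_divide_pi x : in_OK x -> int_gen (pi * x) -> int_gen x.
Proof.
move=> xO [P DP]; have [y yZ Dy] := horner1_mod_pi P.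
have [s sZ Ds] := prime_pi.
have yO := in_OK_int_gen yZ.
have DP1 : (P.[1])%:~R = pi * (x + y) by rewrite mulrDr DP.
have xyO : in_OK (x + y) by apply: in_OK_add.
have /dvdnP[k Dk] := prime_dvd_pi xyO DP1.
have /dvdzP[l Dl] : (p %| P.[1])%Z by rewrite dvdzE Dk dvdn_mull.
have -> : x = l%:~R * s - y.
  apply: (mulfI pi_neq0); rewrite mulrBr mulrCA -Ds DP.
  by move/eqP: Dy; rewrite -subr_eq => /eqP <-; rewrite Dl rmorphM /= -pmulrn.
by apply: int_genB => //; apply: int_genM => //; exact: int_gen_int.
Qed.

(** The trace of [ev b * wz (- k)] is an integer. For a [k] in the coset of
    [i] at which [b] vanishes, it is minus [q] times the sum of [b] over the
    coset. *)
Lemma coset_normal_scaled_int b i :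
  coset_normal b -> in_OK (ev b) -> m%:R * b i \is a Num.int.
Proof.
move=> bN bO.
have key k : m%:R * b k - q%:R * \sum_(j | j ~~> k) b j \is a Num.int.
  apply: (@in_OK_rat L); rewrite -Tr_ev_wz; apply: in_OK_sum => s _.
  apply/in_OK_rmorph; apply: in_OK_mul => //; apply: in_OK_int_gen.
  by exists 'X^(- k); rewrite map_polyXn hornerXn.
have [_ [k ki bk]] := bN i; have := key k; rewrite bk mulr0 => key_k.
rewrite -[m%:R * _](subrK (q%:R * \sum_(j | j ~~> i) b j)) rpredD //.
rewrite -rpredN -[- _]sub0r; congr (_ - _ * _ \is a Num.int): key_k.
by apply: eq_bigl => j; rewrite (eqP ki).
Qed.

(** The trace form shows that [m * x] belongs to Z[w]. A power of [pi] is a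
    multiple of [m = p ^ r], and the factors [pi] can be removed one at a
    time by [int_gen_divide_pi]. *)
Theorem ring_of_integers x : in_OK x -> int_gen x.
Proof.
move=> xO; have [b Dx bN] := coset_normal_of x.
have mxZ : int_gen (m%:R * x).
  rewrite Dx /ev mulr_sumr; apply: int_gen_sum => j.
  have /intrP[z Dz] : m%:R * b j \is a Num.int.
    by rewrite coset_normal_scaled_int -?Dx.
  exists (z *: 'X^j); rewrite map_polyZ map_polyXn !hornerE -/(wz j) /=.
  rewrite (natr_alg m) mulr_algl scalerA Dz scaler_int -mulrzl //.
have [y yZ Dy] := pi_expm.
have piX_Z : int_gen (pi ^+ (m * r) * x).
  rewrite exprM Dy exprMn -natrX mulrAC; apply: int_genM => //.
  exact: int_genX.
elim: (m * r)%N piX_Z => [|k IHk]; first by rewrite mul1r.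
rewrite exprS -mulrA => /int_gen_divide_pi piZ; apply: IHk; apply: piZ.
apply: in_OK_mul => //; apply: in_OK_int_gen; apply: int_genX; exact: int_gen_pi.
Qed.

Lemma coset_normal_int b : coset_normal b -> in_OK (ev b) ->
  forall j, b j \is a Num.int.
Proof.
move=> bN /ring_of_integers[P DP] j.
pose c := poly_coef (map_poly intr P).
have cE : ev c = ev b.
  rewrite ev_poly DP -map_poly_comp; congr (_.[_]).
  by apply: eq_map_poly => z; rewrite /= scaler_int.
have cZ i : c i \is a Num.int by apply: rpred_sum => k _; rewrite coef_map rpred_int.
have [b' [b'E b'N b'D]] := coset_normal_exists c.
rewrite (coset_normal_inj bN b'N) ?b'E ?cE //.
have [_ [i ij b'i]] := b'N j.
by rewrite -[b' j]subr0 -b'i -opprB -b'D // rpredN rpredB.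
Qed.

(** * Subfields of the cyclotomic field *)

(** Any field containing a primitive root of unity [z] of order [m] contains
    a copy of [L], generated by [z]. *)
Lemma subcyclotomic_embedding (K : fieldExtType rat) :
  in_cyclotomic K m -> exists f : {rmorphism K -> L}, True.
Proof.
case=> L0 [z [f [z_prim f_sub]]].
have [j jw] := cyclo_embedding (cyclo_poly_root (in_alg L0) z_prim).
have onto x : exists y, j y = f x.
  have /Fadjoin_polyP[_ /polyOver1P[P ->] ->] : f x \in <<1; z>>%VS.
    by apply: (subvP f_sub); rewrite memv_img ?memvf.
  exists (map_poly (in_alg L) P).[w]; rewrite -jw -horner_map -map_poly_comp.
  by congr (_.[_]); apply: eq_map_poly => a; apply: rmorph_rat_alg.
have [g gE] := choice onto.
have [||h _] := @rmorphism_of K L g; last by exists h.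
- by move=> x y; apply: (fmorph_inj j); rewrite rmorphB !gE rmorphB.
- split=> [|x y]; apply: (fmorph_inj j); first by rewrite gE !rmorph1.
  by rewrite rmorphM !gE rmorphM.
Qed.

Variable K : splittingFieldType rat.
Hypothesis galK : galois 1 {:K}.
Variable iota : {rmorphism K -> L}.

Local Notation n := (\dim {:K}).

Definition iota_hom : 'AHom(K, L) := sval (ahom_of_rmorphism iota).

Lemma iota_homE x : iota_hom x = iota x.
Proof. exact: (svalP (ahom_of_rmorphism iota)). Qed.

Definition iotaK : {subfield L} := (iota_hom @: {:K})%AS.

Lemma mem_iotaK y : reflect (exists x, iota x = y) (y \in iotaK).
Proof.
apply: (iffP memv_imgP) => [[x _ ->] | [x <-]]; exists x; rewrite ?memvf //.
  by rewrite -iota_homE.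
by rewrite -iota_homE.
Qed.

Local Notation G := 'Gal({:L} / iotaK)%g.
Local Notation d := #|G|.

Lemma iota_lker0 : lker iota_hom == 0%VS.
Proof. by apply/lker0P=> x y; rewrite !iota_homE; apply: fmorph_inj. Qed.

Lemma iota_fixed s x : s \in G -> s (iota x) = iota x.
Proof.
move=> sG; apply: (fixed_gal (subvf _) sG).
by apply/mem_iotaK; exists x.
Qed.

Lemma galG : galois iotaK {:L}.
Proof. by apply: galoisS galL; rewrite sub1v subvf. Qed.

Lemma iota_onto_fixed y : (forall s, s \in G -> s y = y) -> exists x, iota x = y.
Proof.
move=> yG; apply/mem_iotaK; rewrite -(galois_fixedField galG).
by apply/fixedFieldP=> //; rewrite memvf.
Qed.

Lemma gal_fix_iota (s : gal_of {:L}) : (forall x, s (iota x) = iota x) -> s \in G.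
Proof.
move=> sK; rewrite gal_kHom ?subvf //; apply/kAHomP=> y /mem_iotaK[x <-].
exact: sK.
Qed.

Lemma card_Gam : #|Gam| = (n * d)%N.
Proof.
rewrite (card_gal_dim galL).
have <- : (\dim {:L} %/ \dim iotaK)%N = d by rewrite galois_dim ?galG.
have <- : \dim iotaK = n by rewrite limg_dim_eq // (eqP iota_lker0) capv0.
by rewrite mulnC divnK // field_dimS ?subvf.
Qed.

Lemma card_Gam_phi : #|Gam| = (q * p.-1)%N.
Proof.
have -> : #|Gam| = #|[pred u : Zm | u \is a GRing.unit]|.
  rewrite -(card_imset _ gal_exp_inj); apply: eq_card => u; rewrite inE.
  apply/imsetP/idP => [[s _ ->] | uU]; first exact: gal_exp_unit.
  by have [s <-] := gal_exp_onto uU; exists s => //; apply: gal_mem.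
have := cardC [pred u : Zm | q%:R * u == 0].
rewrite (card_zp_torsion mE) ?q_gt0 ?p_gt0 // card_Zm => C.
apply: (@addnI q); rewrite -mES -[RHS]C; congr (_ + _)%N; apply: eq_card => u.
by rewrite !inE zp_unitE.
Qed.

(** Through [iota], the automorphism [s] acts on the subfield [iotaK] of the
    normal extension [L], so it extends to [L]. *)
Lemma iota_gal_lift (s : gal_of {:K}) :
  exists t : gal_of {:L}, forall x, iota (s x) = t (iota x).
Proof.
pose g : 'End(L) := (iota_hom \o s \o iota_hom^-1)%VF.
have gE x : g (iota x) = iota (s x).
  by rewrite !lfunE /= lfunE /= -iota_homE lker0_lfunK ?iota_lker0 // iota_homE.
have g_hom : kHom 1 iotaK g.
  rewrite k1HomE; apply/ahom_inP; split=> [_ _ /mem_iotaK[x <-] /mem_iotaK[y <-]|].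
    by rewrite -rmorphM !gE !rmorphM.
  by rewrite -(rmorph1 iota) gE !rmorph1.
have [|t _ tE] := kHom_to_gal _ (normalFieldf 1) g_hom; first by rewrite sub1v subvf.
by exists t => x; rewrite -gE tE //; apply/mem_iotaK; exists x.
Qed.

Lemma Tr_gal (s : gal_of {:L}) x : Tr (s x) = Tr x.
Proof. exact: galTrace_gal (memvf x) (gal_mem s). Qed.

Lemma iota_alg (a : rat) : iota a%:A = a%:A.
Proof. exact: rmorph_rat_alg. Qed.

(** The map [Tr \o iota] is invariant under the automorphisms of [K]. Its
    sum over them is the trace in [L] of the rational number [nf_trace x],
    that is, [n * d] times this number. *)
Lemma Tr_iota x : Tr (iota x) = (d%:R * nf_trace x)%:A.
Proof.
have n0 : (n%:R : L) != 0.
  by rewrite natL_eq0 -lt0n adim_gt0.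
apply: (mulfI n0).
transitivity (\sum_(s in 'Gal({:K} / 1)%g) Tr (iota (s x))).
  rewrite (eq_bigr (fun=> Tr (iota x))); last first.
    by move=> s _; have [t ->] := iota_gal_lift s; rewrite Tr_gal.
  by rewrite sumr_const card_gal_dim // mulr_natl.
rewrite -raddf_sum -rmorph_sum -nf_trace_gal // iota_alg /= /galTrace.
rewrite (eq_bigr (fun=> (nf_trace x)%:A)); last by move=> s _; rewrite rmorph_alg.
rewrite sumr_const card_Gam -[LHS]mulr_natl natrM -mulrA (natr_alg d) mulr_algl.
by rewrite scalerA.
Qed.

Hypothesis K_min : forall k : nat, (0 < k)%N -> in_cyclotomic K k -> (m <= k)%N.

(** * The conductor and the Galois group *)

Lemma geom_sum_eq0 (z : L) : z ^+ p = 1 -> z != 1 -> \sum_(k < p) z ^+ k = 0.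
Proof.
move=> zp z1; apply/eqP; have /esym/eqP := subrX1 z p.
by rewrite zp subrr mulf_eq0 subr_eq0 (negPf z1).
Qed.

Lemma wz_pmul_mem (j : Zm) : q%:R * j == 0 -> wz j \in <<1; w ^+ p>>%VS.
Proof.
rewrite (zp_torsionE _ mE q_gt0) => /dvdnP[k Dk].
by rewrite /wz Dk mulnC exprM rpredX // memv_adjoin.
Qed.

(** Let [gal_exp s = 1 + e], where [p * e = 0], and let [b] be the
    coefficients of an element of [K]. The part of [ev b] supported on the
    units is fixed by [s], so it is the mean of its images by the powers [s
    ^+ k] for [k < p]. If [e <> 0], then for a unit [j] the images of [wz j]
    are the products of [wz j] with all roots of unity of order [p], and
    their mean is 0. Hence [K] is contained in the field of [w ^+ p], which
    contradicts the conductor. *)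
Lemma conductor_exclude s :
  s \in G -> p%:R * (gal_exp s - 1) = 0 -> s = 1%g.
Proof.
move=> sG; set a := gal_exp s; set e := a - 1 => pe.
apply/eqP; apply: contraT => s1.
have e0 : e != 0.
  by rewrite subr_eq0 -gal_exp1 (inj_eq gal_exp_inj).
have qe : q%:R * e = 0.
  by have /dvdnP[k ->] := p_dvd_q; rewrite natrM -mulrA pe mulr0.
have ee : e * e = 0.
  have : p%:R * e == 0 by rewrite pe.
  rewrite (zp_torsionE _ mE' p_gt0) => /dvdnP[k Dk].
  by rewrite -{1}(natr_Zp e) Dk natrM -mulrA qe mulr0.
have aX k : a ^+ k = 1 + e * k%:R.
  elim: k => [|k IHk]; first by rewrite mulr0 addr0 expr0.
  rewrite exprS IHk -[a](subrK 1) -/e mulrDl mul1r mulrDr mulr1 mulrA ee.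
  by rewrite mul0r addr0 addrCA -natr1 mulrDr mulr1 [e + _]addrC.
have aU : a \is a GRing.unit := gal_exp_unit s.
have sub_q : in_cyclotomic K q.
  exists L, (w ^+ p), iota_hom; split.
    have q_dvd : (q %| m)%N by rewrite mE dvdn_mulr.
    by have := dvdn_prim_root w_prim q_dvd; rewrite [X in (X %/ _)%N]mE mulKn ?q_gt0.
  apply/subvP=> _ /mem_iotaK[x <-].
  have [b Dx bN] := coset_normal_of (iota x).
  have ba j : b (a * j) = b j.
    by apply: coset_normal_fixed => //; rewrite -Dx iota_fixed.
  (* The non-units contribute powers of [w ^+ p] only. *)
  pose b' j := if j \is a GRing.unit then b j else 0.
  have b'a k j : b' (a ^+ k * j) = b' j.
    rewrite /b' unitrMr ?unitrX //; case: ifP => // _.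
    by elim: k => [|k IHk]; rewrite ?mul1r // exprS -mulrA ba.
  have b'0 : ev b' = 0.
    have p0 : (p%:R : L) != 0 by rewrite natL_eq0 -lt0n p_gt0.
    apply: (mulfI p0); rewrite mulr0.
    have evk (k : 'I_p) : ev b' = \sum_j b' j *: wz (a ^+ k * j).
      rewrite /ev (reindex_inj (mulrI (unitrX k aU))).
      by apply: eq_bigr => j _; rewrite b'a.
    transitivity (\sum_(k < p) ev b').
      by rewrite sumr_const card_ord mulr_natl.
    rewrite (eq_bigr _ (fun k _ => evk k)) exchange_big big1 //= => j _.
    rewrite -scaler_sumr /b'; case: ifP => [jU|]; last by rewrite scale0r.
    rewrite (eq_bigr (fun k : 'I_p => wz j * wz (e * j) ^+ k)); last first.
      move=> k _; rewrite aX mulrDl mul1r wzD; congr (_ * _).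
      by rewrite mulrAC wzXn.
    rewrite -mulr_sumr geom_sum_eq0 ?mulr0 ?scaler0 //.
      by rewrite -wzXn mulrC mulrA pe mul0r wz0.
    by rewrite wz_eq1 mulrC mulrI_eq0 // ; apply: mulrI.
  rewrite Dx -[ev b]subr0 -b'0 evB /ev rpred_sum // => j _.
  rewrite /b' zp_unitE; case: eqP => [qj|_] /=.
    by rewrite rpredZ // wz_pmul_mem // qj.
  by rewrite subrr scale0r rpred0.
have := K_min q_gt0 sub_q; rewrite mE -{2}(muln1 q) leq_pmul2l ?q_gt0 //.
by rewrite leqNgt p_gt1.
Qed.

(** Congruence to 1 modulo [p], and modulo 4 if [p = 2]. For such [a], the
    quotient [(a ^+ p - 1) / (a - 1)] is [p] times a unit, as [geom_p]
    states. *)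
Definition near1 (a : Zm) :=
  (odd p /\ exists c, a = 1 + p%:R * c) \/ exists c, a = 1 + p%:R * (p%:R * c).

Lemma near1X a k : near1 a -> near1 (a ^+ k).
Proof.
move=> na; elim: k => [|k IHk]; first by right; exists 0; rewrite !mulr0 addr0.
case: na IHk => [[p_odd [c ->]]|[c ->]] [[? [c' E]]|[c' E]]; rewrite exprS E.
- by left; split=> //; exists (c + c' + p%:R * c * c'); ring.
- by left; split=> //; exists (c + p%:R * c' + p%:R * c * (p%:R * c')); ring.
- by left; split=> //; exists (p%:R * c + c' + p%:R * (p%:R * c) * c'); ring.
- by right; exists (c + c' + p%:R * c * (p%:R * c')); ring.
Qed.

Lemma near1_exp a : near1 a -> exists c, a = 1 + p%:R * c.
Proof. by case=> [[_ [c ->]]|[c ->]]; [exists c | exists (p%:R * c)]. Qed.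

Lemma zp_unit_modp k (c : Zm) : ~~ (p %| k)%N -> k%:R + p%:R * c \is a GRing.unit.
Proof.
move=> pk; rewrite zp_unitE mulrDr mulrA -!natrM -mE.
have -> : (m%:R : Zm) = 0 by apply/eqP; rewrite zpn_eq0.
by rewrite mul0r addr0 zpn_eq0 mE dvdn_pmul2l ?q_gt0.
Qed.

Lemma geom_modp a o : near1 a -> exists c, \sum_(i < o) a ^+ i = o%:R + p%:R * c.
Proof.
move=> na; elim: o => [|o [c IHo]]; first by exists 0; rewrite big_ord0 mulr0 addr0.
have [c' E] := near1_exp (near1X o na).
by exists (c + c'); rewrite big_ord_recr /= IHo E -natr1; ring.
Qed.

Lemma expr_1p (c : Zm) i :
  exists z, (1 + p%:R * c) ^+ i = 1 + p%:R * c * i%:R + p%:R * p%:R * z.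
Proof.
elim: i => [|i [z E]]; first by exists 0; rewrite !mulr0 !addr0 expr0.
by exists (c * c * i%:R + z * (1 + p%:R * c)); rewrite exprS E -natr1; ring.
Qed.

(** For [a = 1 + p * c], the sum is [p + p * c * 'C(p, 2)] modulo [p ^+ 2],
    and [p] divides ['C(p, 2)] when it is odd. *)
Lemma geom_p a : near1 a -> exists2 u, u \is a GRing.unit &
  \sum_(i < p) a ^+ i = p%:R * u.
Proof.
have unit1 (c : Zm) : 1 + p%:R * c \is a GRing.unit.
  by apply: (@zp_unit_modp 1); rewrite dvdn1 neq_ltn p_gt1 orbT.
case=> [[p_odd [c ->]]|[c ->]]; last first.
  suff E : forall o, exists z, \sum_(i < o) (1 + p%:R * (p%:R * c)) ^+ i =
      o%:R + p%:R * p%:R * z.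
    by have [z Ez] := E p; exists (1 + p%:R * z) => //; rewrite Ez; ring.
  elim=> [|o [z E]]; first by exists 0; rewrite big_ord0 mulr0 addr0.
  have [z' E'] := expr_1p (p%:R * c) o; exists (z + c * o%:R + z').
  by rewrite big_ord_recr /= E E' -natr1; ring.
have /(_ p)[z E] o : exists z, \sum_(i < o) (1 + p%:R * c) ^+ i =
    o%:R + p%:R * c * 'C(o, 2)%:R + p%:R * p%:R * z.
  elim: o => [|o [z E]].
    by exists 0; rewrite big_ord0 !mulr0 !addr0.
  have [z' E'] := expr_1p c o; exists (z + z').
  by rewrite big_ord_recr /= E E' binS bin1 natrD -natr1; ring.
have /dvdnP[k Dk] : (p %| 'C(p, 2))%N.
  by apply: prime_dvd_bin => //=; case: p p_prime p_odd => [|[|[]]].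
exists (1 + p%:R * (c * k%:R + z)) => //.
by rewrite E Dk natrM; ring.
Qed.

Lemma gal_expX (s : gal_of {:L}) k : gal_exp (s ^+ k)%g = gal_exp s ^+ k.
Proof.
elim: k => [|k IHk]; first by rewrite expg0 gal_exp1.
by rewrite expgS gal_expM IHk exprS.
Qed.

Lemma geom_root_eq0 (a : Zm) o : a ^+ o = 1 -> (a - 1) * \sum_(i < o) a ^+ i = 0.
Proof. by move=> ao; rewrite -subrX1 ao subrr. Qed.

(** Let [a] be the exponent of [s] and [o] its order. If [p] does not divide
    [o], then [\sum_(i < o) a ^+ i] is a unit and [a ^+ o = 1] forces [a =
    1]. If [o = k * p], then [b = a ^+ k] satisfies [b ^+ p = 1], so [p * (b
    - 1) = 0] by [geom_p], and [conductor_exclude] gives [s ^+ k = 1], which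
    is absurd. *)
Lemma near1_fixing s : s \in G -> near1 (gal_exp s) -> s = 1%g.
Proof.
move=> sG na; set a := gal_exp s in na.
have ao : a ^+ #[s]%g = 1 by rewrite -gal_expX expg_order gal_exp1.
have [/dvdnP[k Dk]|pNo] := boolP (p %| #[s]%g)%N; last first.
  have [c E] := geom_modp #[s]%g na.
  have := geom_root_eq0 ao; rewrite E => /(canRL (mulrK (zp_unit_modp c pNo))).
  rewrite mul0r => /eqP; rewrite subr_eq0 -gal_exp1 => /eqP.
  exact: gal_exp_inj.
have nb := near1X k na; set b := a ^+ k in nb.
have bE : b = gal_exp (s ^+ k)%g by rewrite gal_expX.
have bp : b ^+ p = 1 by rewrite -exprM -Dk.
have [u uU E] := geom_p nb.
have := geom_root_eq0 bp; rewrite E mulrA => /(canRL (mulrK uU)).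
rewrite mul0r mulrC bE => /(conductor_exclude (groupX k sG))/eqP.
rewrite -order_dvdn Dk => /dvdn_leq; have : (0 < k)%N.
  by have := order_gt0 s; rewrite Dk muln_gt0 => /andP[].
move=> k0 /(_ k0); rewrite -{2}(muln1 k) leq_pmul2l // leqNgt p_gt1.
by [].
Qed.

Lemma gal_exp_sub1_unit s : odd p -> s \in G -> s != 1%g ->
  gal_exp s - 1 \is a GRing.unit.
Proof.
move=> p_odd sG; apply: contraR; rewrite zp_unitE negbK.
rewrite (zp_torsionE _ mE q_gt0) => /dvdnP[c Dc].
apply/eqP/near1_fixing => //; left; split=> //; exists c%:R.
by rewrite -natrM mulnC -Dc natr_Zp addrC subrK.
Qed.

(** Either the exponent or its opposite is 1 modulo 4. *)
Lemma gal_exp_two s : p = 2 -> (forall t, gal_exp t = -1 -> t \in G) ->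
  s \in G -> gal_exp s = 1 \/ gal_exp s = -1.
Proof.
move=> p2 cG sG; set a := gal_exp s.
have [t tE] : exists t, gal_exp t = -1 by apply: gal_exp_onto; rewrite unitrN unitr1.
have tG := cG t tE.
have aU : a \is a GRing.unit := gal_exp_unit s.
have a_odd : odd a.
  move: aU; rewrite zp_unitE (zp_torsionE _ mE q_gt0) {1}p2 dvdn2 negbK.
  by [].
have pR : p%:R = 2%:R :> Zm := congr1 (fun k => k%:R) p2.
have := congr1 (fun k => k%:R : Zm) (divn_eq a 4); rewrite natr_Zp natrD natrM => Da.
have : (a %% 4 = 1 \/ a %% 4 = 3)%N.
  by have := ltn_pmod a (isT : 0 < 4)%N; move: a_odd; lia.
case=> a4; [left|right].
  rewrite -gal_exp1; congr gal_exp; apply: near1_fixing => //; right.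
  by exists (a %/ 4)%:R; rewrite -/a {1}Da a4 pR; ring.
suff E : (s * t)%g = 1%g.
  have := congr1 gal_exp E; rewrite gal_expM tE gal_exp1 mulrN1 => <-.
  by rewrite opprK.
apply: near1_fixing; first exact: groupM.
right; exists (- (1 + (a %/ 4)%:R)); rewrite gal_expM tE -/a {1}Da a4 pR; ring.
Qed.

Variable R : realType.

(** * Complex conjugation *)

Lemma cyclo_complex_embedding : exists psi : {rmorphism L -> R[i]}, True.
Proof.
have [z rz] : exists z : R[i], root (map_poly ratr cyclo_poly) z.
  apply/closed_rootP; rewrite size_map_poly size_cyclo_poly eqSS muln_eq0 negb_or.
  by rewrite -!lt0n q_gt0 -ltnS prednK ?p_gt0 // p_gt1.
by have [psi _] := cyclo_embedding rz; exists psi.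
Qed.

Variable psi : {rmorphism L -> R[i]}.

Lemma embedding_eq (f g : {rmorphism L -> R[i]}) : f w = g w -> f =1 g.
Proof.
move=> fg x; have [P ->] := cyclo_gen x.
have ratE (h : {rmorphism L -> R[i]}) : h \o in_alg L =1 ratr.
  by move=> a; apply: (fmorph_eq_rat (h \o in_alg L)).
by rewrite -!horner_map -!map_poly_comp !(eq_map_poly (ratE _)) /= fg.
Qed.

(** Both sides are embeddings of [L], and they agree at [w] because [psi w]
    has absolute value 1. *)
Lemma conj_embedding (c : gal_of {:L}) x :
  gal_exp c = -1 -> (psi x)^* = psi (c x).
Proof.
move=> cE; apply: (@embedding_eq (Num.conj \o psi) (psi \o c)) => /=.
have w_norm : `|psi w| = 1.
  apply/eqP; rewrite -(@pexpr_eq1 _ _ m) ?m_gt0 // -normrX -rmorphXn.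
  by rewrite prim_expr_order // rmorph1 normr1.
have psi_w0 : psi w != 0 by rewrite -normr_eq0 w_norm oner_eq0.
apply: (mulfI psi_w0); rewrite -normCK w_norm expr1n -rmorphM gal_expE cE.
have -> : w = wz 1 by rewrite -[1]/(1%:R) wz_nat expr1.
by rewrite -wzD subrr wz0 rmorph1.
Qed.

Hypothesis K_real : totally_real R K.

Lemma conj_fixes_iota (c : gal_of {:L}) : gal_exp c = -1 -> c \in G.
Proof.
move=> cE; apply: gal_fix_iota => x; apply: (fmorph_inj psi).
rewrite -conj_embedding //; apply/CrealP.
have := K_real (psi \o iota : {rmorphism K -> R[i]}) x => /=.
by case: (psi _) => a b /= ->; rewrite complex_real.
Qed.

Lemma conj_exists : exists2 c, c \in G & gal_exp c = -1.
Proof.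
have [c cE] : exists c, gal_exp c = -1 by apply: gal_exp_onto; rewrite unitrN unitr1.
by exists c => //; apply: conj_fixes_iota.
Qed.

Lemma coset_normal_iota x : exists b, [/\ iota x = ev b, coset_normal b,
  forall s, s \in G -> forall j, b (gal_exp s * j) = b j
  & forall j, b (- j) = b j].
Proof.
have [b Dx bN] := coset_normal_of (iota x).
have bG s : s \in G -> forall j, b (gal_exp s * j) = b j.
  by move=> sG; apply: coset_normal_fixed => //; rewrite -Dx iota_fixed.
exists b; split=> // j; have [c cG cE] := conj_exists.
by rewrite -mulN1r -cE bG.
Qed.

Lemma iota_ev_int (c : Zm -> rat) : (forall j, c j \is a Num.int) ->
  (forall s, s \in G -> forall j, c (gal_exp s * j) = c j) ->
  exists2 y, in_OK y & iota y = ev c.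
Proof.
move=> cZ cG; have [s sG|y Dy] := @iota_onto_fixed (ev c).
  rewrite ev_gal; apply: ev_ext => j; rewrite -(cG s sG).
  by rewrite mulrC divrK ?gal_exp_unit.
exists y => //; apply/(in_OK_rmorph iota); rewrite Dy; apply: in_OK_sum => j _.
apply: in_OK_intZ => //; apply: in_OK_int_gen; exists 'X^j.
by rewrite map_polyXn hornerXn.
Qed.

(** * Odd primes: approximation by integers *)

Lemma card_coset (i : Zm) : #|[pred j | j ~~> i]| = p.
Proof.
rewrite -[RHS](card_zp_torsion mE' p_gt0 q_gt0) 
  -(card_imset [pred k : Zm | p%:R * k == 0] (addIr i)).
apply: eq_card => j; rewrite inE; apply/idP/imsetP => [ji|[k]].
  by exists (j - i); rewrite ?subrK // inE mulrBr subr_eq0.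
by rewrite inE => pk ->; rewrite mulrDr (eqP pk) add0r.
Qed.

(** The trace is [q] times the sum, over the cosets, of [p] times the sum of
    the squares of [b] minus the square of the sum of [b]. *)
Lemma Tr_even_square (b : Zm -> rat) : (forall j, b (- j) = b j) ->
  Tr (ev b ^+ 2) =
    (q%:R / 2 * \sum_i \sum_(j | i ~~> j) (b i - b j) ^+ 2)%:A.
Proof.
move=> b_even; rewrite expr2 Tr_ev_ev; congr (_ *: _).
have -> : \sum_i b i * b (- i) = \sum_i b i ^+ 2.
  by apply: eq_bigr => i _; rewrite b_even.
have -> : \sum_i \sum_(j | p%:R * (i + j) == 0) b i * b j =
    \sum_i \sum_(j | i ~~> j) b i * b j.
  apply: eq_bigr => i _; rewrite (reindex_inj oppr_inj) /=.
  by apply: eq_big => [j|j _]; rewrite ?b_even // mulrDr mulrN subr_eq0.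
have sumC (F : Zm -> rat) : \sum_i \sum_(j | i ~~> j) F i = p%:R * \sum_i F i.
  rewrite mulr_sumr; apply: eq_bigr => i _; rewrite (eq_bigl (fun j => j ~~> i)).
    by rewrite sumr_const -[LHS]mulr_natl card_coset.
  by move=> j; rewrite eq_sym.
have -> : \sum_i \sum_(j | i ~~> j) (b i - b j) ^+ 2 =
    2 * (p%:R * (\sum_i b i ^+ 2) - \sum_i \sum_(j | i ~~> j) b i * b j).
  transitivity (\sum_i \sum_(j | i ~~> j) b i ^+ 2 +
     (\sum_i \sum_(j | i ~~> j) b j ^+ 2) - 2 * \sum_i \sum_(j | i ~~> j) b i * b j).
    rewrite mulr_sumr -big_split -sumrB /=; apply: eq_bigr => i _.
    rewrite mulr_sumr -big_split -sumrB /=; apply: eq_bigr => j _; ring.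
  rewrite [X in _ + X - _](exchange_big_dep predT) //=.
  have -> : \sum_j \sum_(i | i ~~> j) b j ^+ 2 = \sum_j \sum_(i | j ~~> i) b j ^+ 2.
    by apply: eq_bigr => j _; apply: eq_bigl => i; rewrite eq_sym.
  by rewrite !(sumC (fun i => b i ^+ 2)); ring.
by rewrite {1}mE natrM; field.
Qed.

(** Besides the diagonal, the pairs [(q, - q)] and [(- q, q)] in the coset
    of 0 do not count. They matter only for [p ^ r = 9]. *)
Lemma count_differing_pairs (b : Zm -> rat) : odd p -> (forall j, b (- j) = b j) ->
  (\sum_i #|[pred j | (i ~~> j) && (b i != b j)]| + m + 2 <= m * p)%N.
Proof.
move=> p_odd b_even; pose e : Zm := q%:R.
have pe : p%:R * e = 0 by apply/eqP; rewrite -natrM -mE' zpn_eq0.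
have ee : e != - e.
  rewrite -subr_eq0 opprK -natrD zpn_eq0 addnn -mul2n mE'.
  rewrite dvdn_pmul2r ?q_gt0 // gtnNdvd //; case: p p_prime p_odd => [|[|[]]] //.
have card_le i :
    (#|[pred j | (i ~~> j) && (b i != b j)]| + (1 + ((i == e) + (i == - e))) <= p)%N.
  apply: (leq_trans _ (eq_leq (card_coset i))).
  rewrite -[leqRHS](cardID [pred j | b i != b j]).
  apply: leq_add; first by apply: eq_leq; apply: eq_card => j; rewrite !inE eq_sym.
  have [i_e|ie] := boolP ((i == e) || (i == - e)); last first.
    move: ie; rewrite negb_or => /andP[/negPf -> /negPf ->]; rewrite !addn0.
    by apply/card_gt0P; exists i; rewrite !inE !eqxx.
  have -> : (1 + ((i == e) + (i == - e)) = #|[:: i; - i]|)%N.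
    rewrite (card_uniqP _) /= ?andbT ?inE.
      case/orP: i_e => /eqP ->; rewrite eqxx ?(negPf ee) //.
      by rewrite eq_sym (negPf ee).
    by case/orP: i_e => /eqP ->; rewrite ?opprK // eq_sym.
  apply: subset_leq_card; apply/fintype.subsetP=> j; rewrite !inE.
  have pi0 : p%:R * i = 0 by case/orP: i_e => /eqP ->; rewrite ?mulrN pe ?oppr0.
  by case/orP=> /eqP ->; rewrite ?b_even ?mulrN pi0 ?oppr0 !eqxx.
have : (\sum_i (#|[pred j | (i ~~> j) && (b i != b j)]| +
    (1 + ((i == e) + (i == - e)))) <= \sum_(i : Zm) p)%N.
  by apply: leq_sum => i _; apply: card_le.
rewrite sum_nat_const card_Zm !big_split /= sum_nat_const card_Zm muln1.
have delta (x : Zm) : (\sum_i (i == x) = 1)%N.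
  by rewrite (bigD1 x) //= eqxx big1 // => i /negPf ->.
by rewrite !delta addnA.
Qed.

(** All coefficients are rounded by one function of their values, so the
    rounded coefficients have the same invariance under [G] and define an
    element of [K]. *)
Lemma odd_approximation (x : K) : odd p -> exists2 c, in_OK c &
  nf_trace ((x - c) ^+ 2) <= q%:R * (m * p - m - 2)%:R / (8 * d%:R).
Proof.
move=> p_odd; have [b [Dx bN bG b_even]] := coset_normal_iota x.
have [f fZ le_f] := simultaneous_rounding b (fun i j => i ~~> j).
have [||c cO Dc] := @iota_ev_int (fun j => f (b j)); first by [].
  by move=> s sG j; rewrite bG.
exists c => //; have d0 : 0 < (d%:R : rat) by rewrite ltr0n cardG_gt0.
have : Tr (iota ((x - c) ^+ 2)) = (q%:R / 2 *
    \sum_i \sum_(j | i ~~> j) ((b i - f (b i)) - (b j - f (b j))) ^+ 2)%:A.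
  rewrite rmorphXn rmorphB Dx Dc evB Tr_even_square // => j.
  by rewrite !b_even.
rewrite Tr_iota => /(fmorph_inj (in_alg L)) E.
rewrite ler_pdivlMr ?mulr_gt0 // mulrCA [nf_trace _ * _]mulrC E mulrC.
have le_count := count_differing_pairs p_odd b_even.
apply: (@le_trans _ _ (q%:R / 2 * ((m * p - m - 2)%:R / 4) * 8)); last by lra.
rewrite ler_wpM2r // ler_wpM2l ?divr_ge0 //.
apply: le_trans le_f _; rewrite ler_wpM2r // ler_nat.
by rewrite -subnDA leq_subRL ?addnA // 1?addnC ?addnA //; lia.
Qed.

(** * Odd primes: the discriminant *)

Definition exp_mul (j : Zm) (s : gal_of {:L}) : Zm := j * gal_exp s.

Lemma exp_mul1 : exp_mul^~ 1%g =1 id.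
Proof. by move=> j; rewrite /exp_mul gal_exp1 mulr1. Qed.

Lemma exp_mulM : forall j, act_morph exp_mul j.
Proof. by move=> j s t; rewrite /exp_mul gal_expM mulrA. Qed.

Definition exp_act := TotalAction exp_mul1 exp_mulM.

Definition torsion a : {set Zm} := [set k | a%:R * k == 0].

Lemma acts_torsion a : [acts G, on torsion a | exp_act].
Proof.
apply/fintype.subsetP=> s sG; rewrite !inE.
apply/fintype.subsetP=> k; rewrite !inE /= /exp_mul.
by rewrite mulrA => /eqP ->; rewrite mul0r.
Qed.

(** By the orbit counting formula: an element [s <> 1] of [G] fixes 0 only,
    since [gal_exp s - 1] is a unit. *)
Lemma card_orbits_torsion a : odd p ->
  (#|orbit exp_act G @: torsion a| * d = #|torsion a| + d.-1)%N.
Proof.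
move=> p_odd; rewrite -Frobenius_Cauchy ?acts_torsion //.
rewrite (bigD1 1%g) //=; congr (_ + _)%N.
  apply: eq_card => k; rewrite !inE finset.sub1set inE /= /exp_mul gal_exp1.
  by rewrite mulr1 eqxx andbT.
rewrite (eq_bigr (fun=> 1%N)) => [|s /andP[sG s1]].
  rewrite (cardsD1 1%g G) group1 /= -sum1_card.
  by apply: eq_bigl => s; rewrite in_setD1 andbC.
rewrite -(cards1 (0 : Zm)); apply: eq_card => k; rewrite !inE finset.sub1set inE /= /exp_mul.
apply/andP/eqP => [[_ /eqP ka]|->]; last by rewrite mulr0 mul0r !eqxx.
apply: (mulIr (gal_exp_sub1_unit p_odd sG s1)).
by rewrite mulrBr mulr1 ka subrr mul0r.
Qed.

Lemma card_torsion_q : #|torsion q| = q.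
Proof.
rewrite -[RHS](card_zp_torsion mE q_gt0 p_gt0); apply: eq_card => k.
by rewrite !inE.
Qed.

Lemma card_torsion_p : #|torsion p| = p.
Proof.
rewrite -[RHS](card_zp_torsion mE' p_gt0 q_gt0); apply: eq_card => k.
by rewrite !inE.
Qed.

Lemma card_G_dvd : odd p -> (d %| p.-1)%N.
Proof.
move=> p_odd; have := card_orbits_torsion p p_odd; rewrite card_torsion_p => E.
have d_gt0 : (0 < d)%N by apply: cardG_gt0.
have : (d %| p + d.-1)%N by rewrite -E dvdn_mull.
by rewrite -{1}(prednK p_gt0) addSnnS prednK // dvdn_addl.
Qed.

Local Notation rho := #|orbit exp_act G @: torsion q|.

Lemma card_orbits_q : odd p -> (rho * d = q + d.-1)%N.
Proof. by move=> p_odd; rewrite card_orbits_torsion ?card_torsion_q. Qed.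

Definition coset_sum (b : Zm -> rat) (k : Zm) : rat := \sum_(j | p%:R * j == k) b j.

Lemma coset_sum_orbit (b : Zm -> rat) k s :
  (forall s, s \in G -> forall j, b (gal_exp s * j) = b j) ->
  s \in G -> coset_sum b (k * gal_exp s) = coset_sum b k.
Proof.
move=> bG sG; have aU := gal_exp_unit s.
rewrite /coset_sum (reindex_inj (mulrI aU)) /=; apply: eq_big => [j|j _].
  by rewrite mulrCA [k * _]mulrC (inj_eq (mulrI aU)).
exact: bG.
Qed.

Lemma coset_sum_int b k : (forall j, b j \is a Num.int) ->
  coset_sum b k \is a Num.int.
Proof. by move=> bZ; apply: rpred_sum. Qed.

Lemma sum_coset_pairs (b b' : Zm -> rat) :
  \sum_i \sum_(j | p%:R * (i + j) == 0) b i * b' j =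
  \sum_(k in torsion q) coset_sum b k * coset_sum b' (- k).
Proof.
rewrite (partition_big (fun i => p%:R * i) (mem (torsion q))) /=; last first.
  move=> i _; rewrite inE mulrA -natrM -mE (_ : m%:R = 0) ?mul0r //.
  by apply/eqP; rewrite zpn_eq0.
apply: eq_bigr => k _; rewrite mulr_suml; apply: eq_bigr => i /eqP pi.
rewrite -mulr_sumr; congr (_ * _); apply: eq_bigl => j.
by rewrite mulrDr pi addrC addr_eq0.
Qed.

(** Up to the factor [d], the Gram matrix is [q *: (p *: U - X *m Y)] with
    integral [U], [X] and [Y]. The sums of a [G]-invariant function over the
    cosets are constant on the orbits of [G], so [X] needs only one column
    per orbit. By [det_low_rank], [m ^ n] divides [p ^ rho * d ^ n] times
    the discriminant, and [d] is prime to [p] since it divides [p - 1]. *)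
Lemma odd_gram_ge (e : n.-tuple K) : odd p -> integral_basis e ->
  m%:R ^+ n <= p%:R ^+ rho * `|\det (gram 1 e)|.
Proof.
move=> p_odd [eB eZ].
have eO i : in_OK (tnth e i).
  apply/eZ => j; rewrite (tnth_nth 0) coord_free ?(basis_free eB) //.
have /choice[b bP] : forall i, exists b, [/\ iota (tnth e i) = ev b,
    forall j, b j \is a Num.int
    & forall s, s \in G -> forall j, b (gal_exp s * j) = b j].
  move=> i; have [b [Dx bN bG _]] := coset_normal_iota (tnth e i).
  exists b; split=> //; apply: coset_normal_int => //; rewrite -Dx.
  exact/in_OK_rmorph.
pose P := orbit exp_act G @: torsion q.
pose rep (O : {set Zm}) := odflt 0 [pick k in O].
have rep_sum O k i : O \in P -> k \in O -> coset_sum (b i) k = coset_sum (b i) (rep O).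
  move=> /imsetP[k0 _ ->] kO; rewrite /rep; case: pickP => [l lO|/(_ k)]; last by rewrite kO.
  have [_ _ bG] := bP i.
  have [s sG <-] := orbitP kO; have [t tG <-] := orbitP lO.
  by rewrite /= /exp_mul !coset_sum_orbit.
pose U := \matrix_(i, j) (\sum_k b i k * b j (- k)) : 'M[rat]_n.
pose X := \matrix_(i, O) coset_sum (b i) (rep (enum_val O)) : 'M[rat]_(n, #|P|).
pose orb_sum j (O : {set Zm}) := \sum_(k in O) coset_sum (b j) (- k).
pose Y := \matrix_(O < #|P|, j < n) orb_sum j (enum_val O) : 'M[rat]_(#|P|, n).
have gramE : d%:R *: gram 1 e = q%:R *: (p%:R *: U - X *m Y).
  apply/matrixP=> i j; rewrite !mxE mul1r; apply: (fmorph_inj (in_alg L)).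
  rewrite /= -Tr_iota rmorphM; have [-> _ _] := bP i; have [-> _ _] := bP j.
  rewrite Tr_ev_ev; congr (_ *: _); rewrite mulrBr mulrA -natrM -mE; congr (_ - _ * _).
  rewrite sum_coset_pairs (set_partition_big _ (orbit_partition (acts_torsion q))) /=.
  rewrite big_enum_val /=; apply: eq_bigr => O _; rewrite !mxE mulr_sumr.
  by apply: eq_bigr => k kO; rewrite (rep_sum _ _ _ (enum_valP O) kO).
have DZ : \det (gram 1 e) \is a Num.int.
  by rewrite -tuple_discr_gram tuple_discr_int.
have D0 : \det (gram 1 e) != 0 by rewrite -tuple_discr_gram tuple_discr_neq0.
have BZ : \det (block_mx U X Y p%:R%:M) \is a Num.int.
  apply: det_int => i j; rewrite mxE.
  case: splitP => i' _; rewrite mxE; case: splitP => j' _; rewrite mxE.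
  - by apply: rpred_sum => k _; apply: rpredM; have [_ bZ _] := bP i'; have [_ bZ' _] := bP j'.
  - by have [_ bZ _] := bP i'; apply: coset_sum_int.
  - by apply: rpred_sum => k _; have [_ bZ _] := bP j'; apply: coset_sum_int.
  - by rewrite rpredMn // rpred_nat.
have main : p%:R ^+ #|P| * (d%:R ^+ n * \det (gram 1 e)) =
    m%:R ^+ n * \det (block_mx U X Y p%:R%:M).
  rewrite -detZ gramE detZ mulrCA det_low_rank mulrA -exprMn -natrM -mE.
  by [].
move: DZ D0 BZ main => /intrP[D ->] D0 /intrP[z ->] main.
have {}main : (p ^ #|P| * (d ^ n * `|D|) = m ^ n * `|z|)%N.
  have := congr1 Num.norm main; rewrite !normrM !normrX !normr_nat -!intr_norm -!natr_absz.
  by rewrite -!natrX -!natrM => /eqP; rewrite eqr_nat => /eqP.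
have co_md : coprime (m ^ n) (d ^ n).
  apply: coprimeXl; apply: coprimeXr; apply: coprimeXl.
  rewrite prime_coprime //; apply/negP=> pd.
  have := dvdn_trans pd (card_G_dvd p_odd) => /dvdn_leq.
  by move: p_gt1; case: (p) => [|[|k]] //= _ /(_ isT); rewrite ltnn.
have D_gt0 : (0 < `|D|)%N by rewrite absz_gt0 -(intr_eq0 rat).
have : (m ^ n %| p ^ #|P| * `|D|)%N.
  rewrite -(Gauss_dvdr _ co_md) mulnCA main.
  exact: dvdn_mulr.
move/dvdn_leq; rewrite muln_gt0 expn_gt0 p_gt0 D_gt0 => /(_ isT).
rewrite -(ler_nat rat) natrM !natrX => /le_trans; apply.
by rewrite natr_absz intr_norm.
Qed.

Lemma p_le_q : (p <= q)%N.
Proof. by rewrite dvdn_leq ?q_gt0 ?p_dvd_q. Qed.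

(** Raised to the power [d], the exponents [n] and [rho] become [q * (p -
    1)] and [q + d - 1], and the inequality is [odd_numeric]. *)
Lemma odd_discr_bound (e : n.-tuple K) : odd p -> integral_basis e ->
  (4 * (q%:R * (m * p - m - 2)%:R / (8 * d%:R)) / n%:R) ^+ n
    <= `|\det (gram 1 e)|.
Proof.
move=> p_odd eB; have D_ge := odd_gram_ge p_odd eB.
have d_gt0 : (0 < d)%N by apply: cardG_gt0.
have n_gt0 : (0 < n)%N by apply: adim_gt0.
have p1_gt0 : (0 < p.-1)%N by rewrite -ltnS prednK ?p_gt0 // p_gt1.
have d_le : (d <= p.-1)%N by rewrite dvdn_leq ?card_G_dvd.
have nd : (n * d = q * p.-1)%N by rewrite -card_Gam card_Gam_phi.
set N0 := (m * p - m - 2)%N.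
have -> : 4 * (q%:R * N0%:R / (8 * d%:R)) / n%:R = N0%:R / (2 * p.-1)%:R :> rat.
  have ndR : n%:R * d%:R = q%:R * p.-1%:R :> rat by rewrite -!natrM nd.
  rewrite natrM; apply/eqP; rewrite eqr_div ?mulf_neq0 ?pnatr_eq0 -?lt0n //.
  apply/eqP; transitivity (q%:R * p.-1%:R * N0%:R / d%:R : rat).
    by field; rewrite pnatr_eq0 -lt0n.
  by rewrite -ndR; field; rewrite pnatr_eq0 -lt0n.
rewrite -(ler_pM2l (x := p%:R ^+ rho)) ?exprn_gt0 ?ltr0n ?p_gt0 //.
apply: le_trans D_ge.
rewrite -(@ler_pXn2r _ d) ?nnegrE ?mulr_ge0 ?exprn_ge0 ?divr_ge0 //.
rewrite exprMn -!exprM card_orbits_q // nd expr_div_n mulrA.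
rewrite ler_pdivrMr ?exprn_gt0 ?ltr0n ?muln_gt0 // -!natrX -!natrM ler_nat.
rewrite -expnMn [(m * _)%N]mulnC.
apply: odd_numeric => //; first 1 last.
- exact: p_le_q.
- exact: mE.
by have := p_gt1; case: (p) p_odd => [|[|[|]]].
Qed.

Theorem odd_case : odd p ->
  (euclidean_minimum R K <=
     (2 ^- (\dim {:K}) * Num.sqrt (ratr `|nf_discr K|) : R)%:E)%E.
Proof.
move=> p_odd.
apply: (@euclidean_minimum_criterion R K galK K_real (psi \o iota) 1 _ _
  (q%:R * (m * p - m - 2)%:R / (8 * d%:R))).
- exact: oner_neq0.
- by move=> s _; rewrite !rmorph1 ler01.
- move=> x; have [c cO le_c] := odd_approximation x p_odd.
  by exists c => //; rewrite mul1r.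
- by move=> e; apply: odd_discr_bound.
Qed.

(** * The prime 2 *)

Section Even.

Hypothesis p2 : p = 2.
Variable c : gal_of {:L}.
Hypotheses (cG : c \in G) (cE : gal_exp c = -1).

Lemma m_even : m = (2 * q)%N.
Proof. by rewrite mE' {1}p2. Qed.

Lemma c_neq1 : c != 1%g.
Proof.
rewrite -(inj_eq gal_exp_inj) cE gal_exp1 eq_sym -subr_eq0 opprK -(natrD _ 1 1).
rewrite zpn_eq0 gtnNdvd // m_even mul2n -addnn.
by apply: (@leq_add 2 1); [apply: leq_trans p_gt1 p_le_q | apply: q_gt0].
Qed.

Lemma G_even s : s \in G -> s = 1%g \/ s = c.
Proof.
move=> sG; have [sE|sE] := gal_exp_two p2 (@conj_fixes_iota) sG; [left|right].
  by apply: gal_exp_inj; rewrite gal_exp1.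
by apply: gal_exp_inj; rewrite cE.
Qed.

Lemma card_G_even : d = 2.
Proof.
have -> : G = [set 1%g; c] :> {set _}.
  apply/setP=> s; rewrite in_set2; apply/idP/orP.
    by case/G_even=> ->; rewrite eqxx; [left|right].
  by case=> /eqP ->; rewrite ?group1.
by rewrite cards2 eq_sym c_neq1.
Qed.

Lemma q_even : q = (2 * n)%N.
Proof. by have := card_Gam_phi; rewrite card_Gam card_G_even p2 muln1 mulnC. Qed.

Lemma even_fixed y : c y = y -> exists x, iota x = y.
Proof.
by move=> cy; apply: iota_onto_fixed => s /G_even[]->; rewrite ?gal_id.
Qed.

Lemma wz1 : wz 1 = w.
Proof. by rewrite -[1]/(1%:R) wz_nat expr1. Qed.

Lemma c_wz j : c (wz j) = wz (- j).
Proof. by rewrite gal_wz cE mulN1r. Qed.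

Lemma c_pi : c pi = - wz (-1) * pi.
Proof.
by rewrite rmorphB rmorph1 /= -wz1 c_wz mulrBr mulr1 mulNr -wzD addNr wz0 opprK addrC.
Qed.

Lemma conj_alpha_exists : exists al, iota al = pi * c pi.
Proof.
apply: even_fixed; rewrite rmorphM [in LHS]mulrC; congr (_ * _).
by rewrite !rmorphB !rmorph1 /= -wz1 !c_wz opprK.
Qed.

(** The sum of the [w ^+ j] for [j] from [- t] to [t], a geometric sum of
    which the factor [pi] leaves only the two ends. *)
Definition interval_sum t := wz (- t%:R) * \sum_(i < t.*2.+1) w ^+ i.

Lemma pi_interval_sum t : pi * interval_sum t = wz (- t%:R) - wz t.+1%:R.
Proof.
rewrite mulrCA -opprB mulNr -subrX1 opprB mulrBr mulr1 -wz_nat -wzD.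
congr (_ - wz _); rewrite -addnn -addnS natrD addrA addNr add0r //.
Qed.

Lemma c_interval_sum t : c (interval_sum t) = interval_sum t.
Proof.
apply: (mulfI pi_neq0); apply: (mulfI (wz_neq0 (-1))).
have := congr1 c (pi_interval_sum t); rewrite rmorphM /= c_pi rmorphB /= !c_wz opprK.
rewrite -!mulrA mulNr => /(congr1 -%R); rewrite opprK => ->.
rewrite pi_interval_sum mulrBr -!wzD opprB; congr (wz _ - wz _).
  by rewrite -opprD addrC natr1.
by rewrite -natr1 addrCA addNr addr0.
Qed.

Lemma in_OK_wz j : in_OK (wz j).
Proof. by apply: in_OK_int_gen; exists 'X^j; rewrite map_polyXn hornerXn. Qed.

Lemma interval_elt t : exists x, iota x = interval_sum t /\ in_OK x.
Proof.
have [x Dx] := even_fixed (c_interval_sum t); exists x; split=> //.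
apply/(in_OK_rmorph iota); rewrite Dx; apply: in_OK_mul; first exact: in_OK_wz.
by apply: in_OK_sum => i _; rewrite -wz_nat; apply: in_OK_wz.
Qed.

Lemma Tr_wz_nat u : (u < q)%N -> Tr (wz u%:R) = ((u == 0)%N%:R * q%:R : rat)%:A.
Proof.
move=> uq; have pu : (p%:R * u%:R == 0 :> Zm) = (q %| u)%N.
  by rewrite -natrM zpn_eq0 mE' dvdn_pmul2l ?p_gt0.
have small k : (q <= k)%N -> (k %| u)%N = (u == 0)%N.
  move=> qk; have [->|u0] := posnP u; first by rewrite dvdn0.
  by rewrite gtnNdvd ?(leq_trans uq) // eqn0Ngt u0.
rewrite Tr_wz pu zpn_eq0 !small // ?m_even ?leq_pmull //.
case: eqP => _; last by rewrite !mul0r subrr scale0r.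
by rewrite !mul1r mul2n -addnn natrD addrK natr_alg.
Qed.

Lemma Tr_wzN j : Tr (wz (- j)) = Tr (wz j).
Proof. by rewrite -c_wz Tr_gal. Qed.

Variables (al : K) (g : n.-tuple K).
Hypothesis alE : iota al = pi * c pi.
Hypothesis gE : forall t : 'I_n, iota (tnth g t) = interval_sum t.
Hypothesis gO : forall t, in_OK (tnth g t).

(** Only the ends of the two intervals remain. Their exponents [- s], [s +
    1] and [t], [- t - 1] combine to [t - s], [s - t] and the opposite
    numbers [s + t + 1] and [- s - t - 1]; the last two have trace 0. *)
Lemma Tr_interval_sums (s t : 'I_n) :
  Tr (pi * c pi * (interval_sum s * interval_sum t)) =
    (2 * ((s == t)%:R * q%:R) : rat)%:A.
Proof.
rewrite -(c_interval_sum t) mulrACA -rmorphM /= !pi_interval_sum rmorphB /= !c_wz opprK.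
rewrite mulrBl !mulrBr -!wzD !raddfB /=.
have off (i j : nat) : (i < n)%N -> (j < n)%N -> Tr (wz (i.+1%:R + j%:R)) = 0.
  move=> i_lt j_lt; rewrite -natrD Tr_wz_nat ?addSn ?mul0r ?scale0r // q_even.
  by move: i_lt j_lt; lia.
have diag (i j : nat) : (i < n)%N -> (j < n)%N ->
    Tr (wz (i%:R - j%:R)) = ((i == j)%:R * q%:R : rat)%:A.
  move=> i_lt j_lt; wlog ij : i j i_lt j_lt / (j <= i)%N.
    move=> H; have [|/ltnW] := leqP j i; first exact: H.
    by move/(H j i j_lt i_lt); rewrite -Tr_wzN opprB eq_sym.
  rewrite -natrB // Tr_wz_nat; last by rewrite q_even; move: i_lt; lia.
  by rewrite subn_eq0 [in RHS]eqn_leq ij andbT.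
have [s_lt t_lt] := (ltn_ord s, ltn_ord t).
rewrite off // -opprD Tr_wzN [s%:R + _]addrC off // addrC.
have -> : s.+1%:R - t.+1%:R = s%:R - t%:R :> Zm by rewrite -!natr1; ring.
have -> : - s%:R + t%:R = - (s%:R - t%:R) :> Zm by rewrite opprB addrC.
rewrite Tr_wzN diag // oppr0 add0r opprK addr0 -scalerDl.
by congr (_ *: _); rewrite val_eqE; ring.
Qed.

Lemma even_trace (s t : 'I_n) :
  nf_trace (al * (tnth g s * tnth g t)) = (s == t)%:R * q%:R.
Proof.
have := Tr_interval_sums s t; rewrite -!gE -alE -!(rmorphM iota) Tr_iota.
by move/(fmorph_inj (in_alg L)); rewrite card_G_even; apply: (mulfI (isT : 2 != 0 :> rat)).
Qed.

Lemma even_gram : gram al g = (q%:R)%:M.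
Proof. by apply/matrixP=> s t; rewrite !mxE even_trace mulr_natl mulrb. Qed.

Lemma even_basis : basis_of {:K} g.
Proof.
apply: basis_of_discr; have : \det (gram al g) != 0.
  by rewrite even_gram det_scalar expf_neq0 // pnatr_eq0 -lt0n q_gt0.
by rewrite det_gram // mulf_eq0 negb_or => /andP[].
Qed.

Lemma even_coord_trace x t : nf_trace (al * (x * tnth g t)) = q%:R * coord g t x.
Proof.
rewrite {1}(coord_basis even_basis (memvf x)) mulr_suml mulr_sumr linear_sum.
rewrite (bigD1 t) //= big1 ?addr0 => [|s st]; last first.
  by rewrite -scalerAl -scalerAr linearZ /= -tnth_nth even_trace (negPf st) mul0r mulr0.
by rewrite -scalerAl -scalerAr linearZ /= -tnth_nth even_trace eqxx mul1r mulrC.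
Qed.

(** By orthogonality, [q] times the coordinate along [g_t] is the trace of
    [al * x * g_t]. If [iota x = ev b], this trace is [q] times a difference
    of values of the integral function [a i = 2 * b i - \sum_(j ~~> i) b j]. *)
Lemma even_coord_int x t : in_OK x -> coord g t x \is a Num.int.
Proof.
move=> xO; have [b [Dx bN _ b_even]] := coset_normal_iota x.
have bZ : forall j, b j \is a Num.int.
  by apply: coset_normal_int => //; rewrite -Dx; apply/in_OK_rmorph.
pose a i := 2 * b i - \sum_(j | j ~~> i) b j.
have aZ i : a i \is a Num.int by rewrite rpredB ?rpredM ?rpred_nat ?rpred_sum.
have TrE i : Tr (ev b * wz (- i)) = (q%:R * a i)%:A.
  by rewrite Tr_ev_wz; congr (_ *: _); rewrite /a {1}m_even natrM; ring.
have a_even i : a (- i) = a i.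
  rewrite /a b_even; congr (_ - _); rewrite (reindex_inj oppr_inj) /=.
  apply: eq_big => [j|j _]; last exact: b_even.
  by rewrite !mulrN (inj_eq oppr_inj).
suff -> : coord g t x = a t%:R - a t.+1%:R by rewrite rpredB.
have q0 : (q%:R : rat) != 0 by rewrite pnatr_eq0 -lt0n q_gt0.
apply: (mulfI q0); rewrite -even_coord_trace.
have : Tr (iota (al * (x * tnth g t))) = (2 * (q%:R * (a t%:R - a t.+1%:R)) : rat)%:A.
  have -> : iota (al * (x * tnth g t)) = ev b * wz t%:R - ev b * wz (- t.+1%:R) -
      (ev b * wz t.+1%:R - ev b * wz (- t%:R)).
    have step1 : wz t.+1%:R = wz 1 * wz t%:R by rewrite -wzD -natr1 addrC.
    have step2 : wz (- t%:R) = wz 1 * wz (- t.+1%:R).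
      by rewrite -wzD -natr1 opprD addrCA subrr addr0.
    transitivity (ev b * (pi * c (pi * interval_sum t))).
      by rewrite !(rmorphM iota) /= alE gE Dx [c (pi * _)]rmorphM /= c_interval_sum; ring.
    rewrite pi_interval_sum rmorphB /= !c_wz opprK step1 [in RHS]step2 wz1; ring.
  have TrE' i : Tr (ev b * wz i) = (q%:R * a i)%:A.
    by have := TrE (- i); rewrite opprK a_even.
  have TrB y z : Tr (y - z) = Tr y - Tr z by exact: raddfB.
  rewrite !TrB !TrE' !a_even -!scalerBl.
  by congr (_ *: _); ring.
rewrite Tr_iota card_G_even => /(fmorph_inj (in_alg L)).
exact: (mulfI (isT : 2 != 0 :> rat)).
Qed.

Lemma even_square_trace (z : K) :
  nf_trace (al * z ^+ 2) = q%:R * \sum_t coord g t z ^+ 2.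
Proof.
rewrite expr2 {2}(coord_basis even_basis (memvf z)) !mulr_sumr linear_sum.
apply: eq_bigr => t _ /=; rewrite -!scalerAr linearZ /= -tnth_nth even_coord_trace.
by rewrite mulrCA -expr2.
Qed.

Lemma even_approximation x : exists2 y, in_OK y &
  nf_trace (al * (x - y) ^+ 2) <= q%:R * n%:R / 4.
Proof.
pose rd (z : rat) : rat := (Num.floor (z + 2^-1))%:~R.
have rdP z : (z - rd z) ^+ 2 <= 4^-1.
  have := floor_le_tmp (z + 2^-1); have := floorD1_gt (z + 2^-1).
  rewrite rmorphD /= -/(rd z) => lt1 le1; nra.
pose y := \sum_t rd (coord g t x) *: g`_t.
exists y.
  apply: in_OK_sum => t _; apply: in_OK_intZ; first exact: rpred_int.
  by rewrite -tnth_nth.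
set z := x - y; have zE t : coord g t z = coord g t x - rd (coord g t x).
  by rewrite linearB /= coord_sum_free ?(basis_free even_basis).
rewrite even_square_trace -mulrA ler_wpM2l //.
apply: (@le_trans _ _ (\sum_(t < n) 4^-1)); last first.
  by rewrite sumr_const card_ord -[leLHS]mulr_natl.
by apply: ler_sum => t _; rewrite zE rdP.
Qed.

(** An integral basis is the image of [g] by an integral matrix of nonzero
    determinant. *)
Lemma even_gram_ge (e : n.-tuple K) : integral_basis e ->
  q%:R ^+ n <= `|\det (gram al e)|.
Proof.
move=> [eB eZ].
have eO i : in_OK (tnth e i).
  by apply/eZ => j; rewrite (tnth_nth 0) coord_free ?(basis_free eB).
rewrite (gram_basis_change _ _ even_basis); set A := \matrix_(_, _) _.
rewrite even_gram !det_mulmx det_tr det_scalar mulrAC -expr2 normrM.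
rewrite [`|q%:R ^+ n|]ger0_norm ?exprn_ge0 //.
rewrite ler_peMl ?exprn_ge0 // normrX exprn_ege1 //.
have /intrP[z Dz] : \det A \is a Num.int.
  by apply: det_int => i j; rewrite mxE even_coord_int.
have : \det A != 0.
  have : \det (gram al e) != 0.
    rewrite det_gram // mulf_neq0 ?tuple_discr_neq0 // nf_norm_neq0 //.
    by rewrite -(fmorph_eq0 iota) alE mulf_neq0 ?fmorph_eq0 ?pi_neq0.
  rewrite (gram_basis_change _ _ even_basis) -/A !det_mulmx.
  by rewrite -mulrA mulf_eq0 negb_or => /andP[].
rewrite Dz intr_eq0 -intr_norm => z0.
by rewrite (ler_int _ 1) -gtz0_ge1 normr_gt0.
Qed.

(** In every complex embedding [al] is the square of the absolute value of
    the image of [1 - w]. *)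
Lemma even_alpha_ge0 (s : gal_of {:K}) : 0 <= psi (iota (s al)).
Proof.
have [t ->] := iota_gal_lift s; rewrite alE rmorphM rmorphM /=.
have -> : t (c pi) = c (t pi).
  have ct : (c * t)%g = (t * c)%g by apply: gal_exp_inj; rewrite !gal_expM mulrC.
  by rewrite -galM ?memvf // ct galM ?memvf.
by rewrite -(conj_embedding (t pi) cE) mul_conjC_ge0.
Qed.

End Even.

Theorem even_case : p = 2 ->
  (euclidean_minimum R K <=
     (2 ^- (\dim {:K}) * Num.sqrt (ratr `|nf_discr K|) : R)%:E)%E.
Proof.
move=> p2; have [c cG cE] := conj_exists.
have [al alE] := conj_alpha_exists p2 cE.
have /choice[f fE] t := interval_elt p2 cE t.
pose g : n.-tuple K := [tuple f t | t < n].
have gE (t : 'I_n) : iota (tnth g t) = interval_sum t.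
  by rewrite tnth_mktuple (fE t).1.
have gO t : in_OK (tnth g t) by rewrite tnth_mktuple; have [] := fE t.
apply: (@euclidean_minimum_criterion R K galK K_real (psi \o iota) al _ _
  (q%:R * n%:R / 4)).
- by rewrite -(fmorph_eq0 iota) alE mulf_neq0 ?fmorph_eq0 ?pi_neq0.
- by move=> s _; apply: even_alpha_ge0 alE s.
- by move=> x; apply: (even_approximation p2 cG cE alE gE gO).
move=> e eB; apply: le_trans (even_gram_ge p2 cG cE alE gE eB).
have n0 : (n%:R : rat) != 0 by rewrite pnatr_eq0 -lt0n adim_gt0.
by rewrite (_ : 4 * _ / _ = q%:R) //; field.
Qed.

End PrimePowerCyclotomic.

(** * The bound on the Euclidean minimum *)

Theorem mainTheorem1 (R : realType) (p r : nat) (K : splittingFieldType rat)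
    (p_prime : prime p) (r_ge2 : (2 <= r)%N)
    (K_real : totally_real R K) (K_abelian : abelian_field K)
    (K_cond : is_conductor K (p ^ r)%N) :
  (euclidean_minimum R K <=
     (2 ^- (\dim {:K}) * Num.sqrt (ratr `|nf_discr K|) : R)%:E)%E.
Proof.
have [galK _] := K_abelian; have [m_gt0 K_cyc K_min] := K_cond.
have [L galL [toC _ [w [w_prim w_gen] _]]] :=
  group_num_field_exists [set: 'Z_(p ^ r)]%G.
rewrite cardsT (card_Zm p_prime r_ge2) in w_prim.
have [iota _] := subcyclotomic_embedding p_prime r_ge2 w_prim w_gen toC K_cyc.
have [psi _] := cyclo_complex_embedding p_prime r_ge2 w_prim w_gen toC R.
have [p2|p_odd] := even_prime p_prime.
  exact: (even_case p_prime r_ge2 galL w_prim w_gen toC galK iota K_min psi K_real p2).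
exact: (odd_case p_prime r_ge2 galL w_prim w_gen toC galK iota K_min psi K_real p_odd).
Qed.
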